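(* Let $N,M\ge1$ be integers. The sets $\mathcal{F}_0,\mathcal{F}_1,\dots,\mathcal{F}_N$ of operators on $L^2([0,1]^N,\mathbb{C}^M)$ defined in the context are groups under composition, and $$\mathcal{F}_0=\{\mathbf{A}\cdot:\ \det\mathbf{A}\ne0\},\qquad \mathcal{F}_j=\{\mathcal{I}+\mathbf{A}\langle\mathbf{B}\cdot\rangle_j:\ \det(\mathbf{I}+\langle\mathbf{B}\mathbf{A}\rangle_j)\neq0\},\quad j=1,\dots,N,$$ where $\mathbf A$, $\mathbf B$ range over continuous matrix-valued functions of appropriate sizes and ''$\ne 0$'' means that the determinant, which is a function, is nonzero for every value of its argument. For $j\ge 1$ the inverse of an element of $\mathcal{F}_j$ has the form $$(\mathcal{I}+\mathbf{A}\langle\mathbf{B}\cdot\rangle_j)^{-1}=\mathcal{I}-\mathbf{A}(\mathbf{I}+\langle\mathbf{B}\mathbf{A}\rangle_j)^{-1}\langle\mathbf{B}\cdot\rangle_j.$$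
   Context: For $1\le j\le N$, $\langle\cdot\rangle_j:=\int_{[0,1]^j}\cdot\;dk_1\cdots dk_j$ (applied entrywise to scalar-, vector- or matrix-valued functions of $\mathbf{k}=(k_1,\dots,k_N)\in[0,1]^N$); the result depends only on $(k_{j+1},\dots,k_N)$ and is regarded also as a function on $[0,1]^N$ that is constant in $k_1,\dots,k_j$. $\mathbf{A}\cdot$ denotes the operator of multiplication by $\mathbf{A}$, and $\mathbf{A}\langle\mathbf{B}\cdot\rangle_j$ denotes the operator $\mathbf{u}\mapsto\mathbf{A}\langle\mathbf{B}\mathbf{u}\rangle_j$. Let $\mathcal{H}_0=\{\mathbf{A}\cdot\}$, with $\mathbf{A}$ ranging over continuous $M\times M$ matrix-valued functions on $[0,1]^N$, and for $j=1,\dots,N$ let $\mathcal{H}_j=\{\mathbf{A}\langle\mathbf{B}\cdot\rangle_j\}$, with $\mathbf{A}$, $\mathbf{B}$ ranging over continuous matrix-valued functions on $[0,1]^N$ of sizes $M\times M'$ and $M'\times M$, $M'$ any positive integer. $\mathrm{Inv}(S)$ denotes the set of elements of $S$ that are invertible as bounded operators on $L^2([0,1]^N,\mathbb{C}^M)$. Define $\mathcal{F}_0=\mathrm{Inv}(\mathcal{H}_0)$ and $\mathcal{F}_j=\mathrm{Inv}(\{\mathcal{I}+\mathcal{A}:\mathcal{A}\in\mathcal{H}_j\})$ for $j=1,\dots,N$. $\mathcal{I}$ is the identity operator, $\mathbf{I}$ the identity matrix of appropriate size. *)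

(* Defs.v *)
From HB Require Import structures.
From mathcomp Require Import all_boot all_order all_algebra.
From mathcomp Require Import ring_quotient complex.
From mathcomp Require Import ring lra.
From mathcomp Require Import all_classical all_reals all_analysis measurable_realfun.
Set Implicit Arguments. Unset Strict Implicit. Unset Printing Implicit Defensive.
Import Order.TTheory GRing.Theory Num.Theory.
Import numFieldNormedType.Exports.
Local Open Scope classical_set_scope.
Local Open Scope ring_scope.
Local Open Scope complex_scope.

Definition measure_rV_display : measure_display -> measure_display.
Proof. exact. Qed.

Section measurable_rV.
Context {d} {T : measurableType d}.
Variable n : nat.

Let coors : 'I_n -> 'rV[T]_n -> T := fun i x => x ord0 i.

Let rV_set0 : g_sigma_preimage coors set0.
Proof. exact: sigma_algebra0. Qed.

Let rV_setC A : g_sigma_preimage coors A -> g_sigma_preimage coors (~` A).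
Proof. exact: sigma_algebraC. Qed.

Let rV_bigcup (F : _^nat) : (forall i, g_sigma_preimage coors (F i)) ->
  g_sigma_preimage coors (\bigcup_i (F i)).
Proof. exact: sigma_algebra_bigcup. Qed.

HB.instance Definition _ := @isMeasurable.Build (measure_rV_display d)
  'rV[T]_n (g_sigma_preimage coors) rV_set0 rV_setC rV_bigcup.

End measurable_rV.

Lemma measurable_rV_coord d (T : measurableType d) n (i : 'I_n) :
  measurable_fun [set: 'rV[T]_n] (fun x => x ord0 i).
Proof.
move=> _ Y mY; rewrite setTI; apply: sub_sigma_algebra => /=.
rewrite -bigcup_seq/=; exists i => /=; first by rewrite mem_index_enum.
by exists Y => //; rewrite setTI.
Qed.

Lemma measurable_rVP d d' (S : measurableType d) (T : measurableType d') n
    (f : S -> 'rV[T]_n) :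
  (forall i, measurable_fun setT (fun x => f x ord0 i)) -> measurable_fun setT f.
Proof.
move=> mf; apply: (@measurability _ _ _ _ _ _
  (\big[setU/set0]_(i < n) preimage_set_system setT (fun x : 'rV[T]_n => x ord0 i) measurable)) => //.
move=> _ [B + <-]; rewrite -bigcup_seq => -[i _ [A mA <-]].
by rewrite setTI; have := mf i measurableT A mA; rewrite setTI.
Qed.

Section lebesgue_rV.
Variable R : realType.

(* (a, x) |-> (a, x_1, ..., x_n) *)
Definition cons_rV n (p : measurableTypeR R * 'rV[R]_n) : 'rV[R]_n.+1 :=
  \row_i (if unlift ord0 i is Some j then p.2 ord0 j else p.1).

Definition uncons_rV n (x : 'rV[R]_n.+1) : measurableTypeR R * 'rV[R]_n :=
  (x ord0 ord0, \row_i x ord0 (lift ord0 i)).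

Lemma cons_rV0 n p : @cons_rV n p ord0 ord0 = p.1.
Proof. by rewrite mxE unlift_none. Qed.

Lemma cons_rVS n p i : @cons_rV n p ord0 (lift ord0 i) = p.2 ord0 i.
Proof. by rewrite mxE liftK. Qed.

Lemma cons_rVK n : cancel (@cons_rV n) (@uncons_rV n).
Proof.
move=> [a x]; rewrite /uncons_rV cons_rV0; congr pair.
by apply/rowP => i; rewrite mxE cons_rVS.
Qed.

Lemma measurable_cons_rV n : measurable_fun setT (@cons_rV n).
Proof.
apply: measurable_rVP => i; case: (unliftP ord0 i) => [j|] ->.
  under eq_fun do rewrite cons_rVS.
  exact: (measurableT_comp (measurable_rV_coord j)).
by under eq_fun do rewrite cons_rV0; exact: measurable_fst.
Qed.

HB.instance Definition _ n :=
  isMeasurableFun.Build _ _ _ _ (@cons_rV n) (@measurable_cons_rV n).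

Lemma measurable_uncons_rV n : measurable_fun setT (@uncons_rV n).
Proof.
apply: measurable_fun_pair; first exact: measurable_rV_coord.
apply: measurable_rVP => i; under eq_fun do rewrite mxE.
exact: measurable_rV_coord.
Qed.

Section step.
Variables (n : nat) (mu : {sigma_finite_measure set 'rV[R]_n -> \bar R}).

Definition lebesgue_step : set 'rV[R]_n.+1 -> \bar R :=
  pushforward (lebesgue_measure \x mu)%E (@cons_rV n).

Let step0 : lebesgue_step set0 = 0%E.
Proof. exact: measure0. Qed.

Let step_ge0 A : (0 <= lebesgue_step A)%E.
Proof. exact: measure_ge0. Qed.

Let step_sigma_additive : semi_sigma_additive lebesgue_step.
Proof. exact: measure_semi_sigma_additive. Qed.

HB.instance Definition _ := isMeasure.Build _ _ _ lebesgue_step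
  step0 step_ge0 step_sigma_additive.

Let step_sigma_finite : sigma_finite setT lebesgue_step.
Proof.
have /sigma_finiteP[F [FT ndF Foo]] := sigma_finiteT (@lebesgue_measure R).
have /sigma_finiteP[G [GT ndG Goo]] := sigma_finiteT mu.
exists (fun k => @uncons_rV n @^-1` (F k `*` G k)).
  rewrite -preimage_bigcup (_ : \bigcup_i _ = setT) ?preimage_setT//.
  apply/seteqP; split=> // -[x y] _.
  have [k _ Fkx] : (\bigcup_i F i) x by rewrite -FT.
  have [l _ Gly] : (\bigcup_i G i) y by rewrite -GT.
  exists (maxn k l) => //; split => /=.
  - by move: Fkx; exact/subsetPset/ndF/leq_maxl.
  - by move: Gly; exact/subsetPset/ndG/leq_maxr.
move=> k; have [mF Fk] := Foo k; have [mG Gk] := Goo k; split.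
  by rewrite -[X in measurable X]setTI; apply: measurable_uncons_rV => //;
    exact: measurableX.
rewrite /lebesgue_step /pushforward -comp_preimage.
rewrite (_ : _ \o _ = id) ?preimage_id; last first.
  by apply/funext => p /=; rewrite cons_rVK.
by rewrite product_measure1E// lte_mul_pinfty// ge0_fin_numE.
Qed.

HB.instance Definition _ := Measure_isSigmaFinite.Build _ _ _ lebesgue_step
  step_sigma_finite.

End step.

(* n-dimensional Lebesgue measure, as an iterated product transported along
   R * R^n ~ R^(n+1) *)
Fixpoint lebesgue_rV n : {sigma_finite_measure set 'rV[R]_n -> \bar R} :=
  match n with
  | 0 => \d_(0 : 'rV[R]_0)
  | n.+1 => lebesgue_step (lebesgue_rV n)
  end.
End lebesgue_rV.

(* The usual topology of the complex numbers, given by the balls of the norm *)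
HB.instance Definition _ (R : rcfType) := PseudoPointedMetric.copy R[i] R[i]^o.

Arguments lebesgue_rV R n : clear implicits.

Section cube.
Variable R : realType.

Definition cube n : set 'rV[R]_n := [set x | forall i, 0 <= x ord0 i <= 1].
Arguments cube n : clear implicits.

Lemma measurable_cube n : measurable (cube n).
Proof.
rewrite (_ : cube n = \bigcap_(i in [set: 'I_n]) ((fun x : 'rV[R]_n => x ord0 i) @^-1` `[0, 1])).
  apply: fin_bigcap_measurable => // i _.
  rewrite -[X in measurable X]setTI; exact: measurable_rV_coord.
apply/seteqP; split => [x xc i _|x xc i] /=; first by rewrite in_itv/=.
by have := xc i I; rewrite /= in_itv.
Qed.

Lemma lebesgue_cube n : lebesgue_rV R n (cube n) = 1%E.
Proof.
elim: n => [|n IHn] /=; first by rewrite diracE mem_set// => -[].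
rewrite /lebesgue_step /pushforward (_ : _ @^-1` _ = `[0, 1] `*` cube n).
  rewrite product_measure1E//; last exact: measurable_cube.
  rewrite [X in (_ * X)%E]IHn mule1.
  have := @lebesgue_measure_itv R `[0, 1]; rewrite /= lte_fin ltr01 oppr0 adde0.
  exact.
apply/seteqP; split => [[x y] xy|[x y] [/= x01 y01] i] /=.
  split => [|i] /=; first by rewrite in_itv/=; have := xy ord0; rewrite cons_rV0.
  by have := xy (lift ord0 i); rewrite cons_rVS.
case: (unliftP ord0 i) => [j|] ->; first by rewrite cons_rVS.
by rewrite cons_rV0; move: x01; rewrite in_itv.
Qed.

End cube.
Arguments cube R n : clear implicits.
Arguments measurable_cube R n : clear implicits.

Section L2.
Variables (R : realType) (N M : nat).
Local Notation mu := (lebesgue_rV R N).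

Definition sqnormC (z : R[i]) : R := complex.Re z ^+ 2 + complex.Im z ^+ 2.

Definition sqnorm_cV (v : 'cV[R[i]]_M) : R := \sum_i sqnormC (v i ord0).

Definition measurable_cV (u : 'rV[R]_N -> 'cV[R[i]]_M) : Prop :=
  forall i, measurable_fun (cube R N) (fun k => complex.Re (u k i ord0)) /\
            measurable_fun (cube R N) (fun k => complex.Im (u k i ord0)).

(* Only the restriction of u to the cube matters *)
Definition square_integrable (u : 'rV[R]_N -> 'cV[R[i]]_M) : Prop :=
  measurable_cV u /\ (\int[mu]_(k in cube R N) (sqnorm_cV (u k))%:E < +oo)%E.

Lemma sqnormC_ge0 z : 0 <= sqnormC z.
Proof. by rewrite addr_ge0 ?sqr_ge0. Qed.

Lemma sqnorm_cV_ge0 v : 0 <= sqnorm_cV v.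
Proof. by apply: sumr_ge0 => i _; exact: sqnormC_ge0. Qed.

Lemma measurable_sqnorm u : measurable_cV u ->
  measurable_fun (cube R N) (fun k => sqnorm_cV (u k)).
Proof.
move=> mu'; apply: measurable_sum => i; have [mr mi] := mu' i.
by apply: measurable_funD; exact: measurable_funX.
Qed.

Definition square_integrable_pred :
  {pred 'rV[R]_N -> 'cV[R[i]]_M} := mem [set u | square_integrable u].

Lemma measurable_cV_lin a u v : measurable_cV u -> measurable_cV v ->
  measurable_cV (a *: u + v).
Proof.
move=> mmu mmv i; have [ur ui] := mmu i; have [vr vi] := mmv i; split.
  rewrite (_ : (fun _ => _) = fun k =>
      (complex.Re a * complex.Re (u k i ord0)
       - complex.Im a * complex.Im (u k i ord0)) + complex.Re (v k i ord0)).
    apply: measurable_funD => //.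
    by apply: measurable_funB; apply: measurable_funM.
  apply/funext => k; rewrite !mxE.
  by case: a (u k i ord0) (v k i ord0) => [? ?] [? ?] [? ?].
rewrite (_ : (fun _ => _) = fun k =>
    (complex.Re a * complex.Im (u k i ord0)
     + complex.Im a * complex.Re (u k i ord0)) + complex.Im (v k i ord0)).
  by apply: measurable_funD => //; apply: measurable_funD; apply: measurable_funM.
apply/funext => k; rewrite !mxE.
by case: a (u k i ord0) (v k i ord0) => [? ?] [? ?] [? ?].
Qed.

Lemma square_integrable_submod : submod_closed square_integrable_pred.
Proof.
have mcube := measurable_cube R N.
split.
  rewrite inE; split => [i|].
    by split; rewrite (_ : (fun _ => _) = cst 0)//; apply/funext => k /=;
      rewrite mxE.
  rewrite integral0_eq// => k _; rewrite /sqnorm_cV big1// => i _.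
  by rewrite mxE /sqnormC /= expr0n addr0.
move=> a u v; rewrite !inE => -[mmu iu] [mmv iv]; split.
  exact: measurable_cV_lin.
have c0 : 0 <= 2 * sqnormC a by rewrite mulr_ge0 ?sqnormC_ge0.
have nE k : sqnorm_cV ((a *: u + v) k) <=
    (2 * sqnormC a) * sqnorm_cV (u k) + 2 * sqnorm_cV (v k).
  rewrite /sqnorm_cV !mulr_sumr -big_split; apply: ler_sum => i _.
  rewrite !mxE; case: a (u k i ord0) (v k i ord0) {c0} => [a b] [c d] [e f].
  rewrite /sqnormC /=.
  have := sqr_ge0 (a * c - b * d - e); have := sqr_ge0 (a * d + b * c - f).
  nra.
have m1 : measurable_fun (cube R N) (fun k => ((2 * sqnormC a) * sqnorm_cV (u k))%:E).
  by apply/measurable_EFinP/measurable_funM => //; exact: measurable_sqnorm.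
have m2 : measurable_fun (cube R N) (fun k => (2 * sqnorm_cV (v k))%:E).
  by apply/measurable_EFinP/measurable_funM => //; exact: measurable_sqnorm.
apply: (@le_lt_trans _ _ (\int[mu]_(k in cube R N)
   (((2 * sqnormC a) * sqnorm_cV (u k))%:E + (2 * sqnorm_cV (v k))%:E))%E).
  apply: ge0_le_integral => //.
  - by move=> k _; rewrite lee_fin sqnorm_cV_ge0.
  - by apply/measurable_EFinP; apply: measurable_sqnorm; exact: measurable_cV_lin.
  - exact: emeasurable_funD.
  - by move=> k _; rewrite -EFinD lee_fin.
rewrite ge0_integralD//; last 2 first.
  - by move=> k _; rewrite lee_fin mulr_ge0// sqnorm_cV_ge0.
  - by move=> k _; rewrite lee_fin mulr_ge0// sqnorm_cV_ge0.
under eq_integral do rewrite EFinM.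
under [X in (_ + X)%E]eq_integral do rewrite EFinM.
rewrite !ge0_integralZl//; last 4 first.
- by apply/measurable_EFinP; exact: measurable_sqnorm.
- by move=> k _; rewrite lee_fin sqnorm_cV_ge0.
- by apply/measurable_EFinP; exact: measurable_sqnorm.
- by move=> k _; rewrite lee_fin sqnorm_cV_ge0.
by rewrite lte_add_pinfty// lte_mul_pinfty.
Qed.

HB.instance Definition _ := GRing.isSubmodClosed.Build _ _
  square_integrable_pred square_integrable_submod.

Record L2fun := MkL2fun {
  L2fun_val :> 'rV[R]_N -> 'cV[R[i]]_M;
  _ : L2fun_val \in square_integrable_pred }.

HB.instance Definition _ := [isSub for L2fun_val].
HB.instance Definition _ := [Choice of L2fun by <:].
HB.instance Definition _ := [SubChoice_isSubLmodule of L2fun by <:].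

Definition L2null : {pred L2fun} :=
  mem [set u : L2fun | (u : 'rV[R]_N -> 'cV[R[i]]_M) = 0 %[ae mu in cube R N]].

Lemma L2null_submod : submod_closed L2null.
Proof.
split; first by rewrite inE; exact: aeW.
move=> a u v; rewrite !inE; apply: filterS2 => k uk vk kc.
change (a *: L2fun_val u k + L2fun_val v k = 0).
by rewrite (uk kc : L2fun_val u k = 0) (vk kc : L2fun_val v k = 0) scaler0 addr0.
Qed.

HB.instance Definition _ := GRing.isSubmodClosed.Build _ _ L2null L2null_submod.

Definition L2 := Quotient.quot L2null.
HB.instance Definition _ := Choice.on L2.
HB.instance Definition _ := GRing.Zmodule.on L2.

Local Open Scope quotient_scope.

Definition L2scale (a : R[i]) (u : L2) : L2 := \pi_L2 (a *: repr u).

Lemma pi_L2Z a f : \pi_L2 (a *: f) = L2scale a (\pi_L2 f).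
Proof.
apply/eqP; rewrite -Quotient.idealrBE -scalerBr rpredZ//.
by rewrite Quotient.idealrBE reprK.
Qed.

Lemma pi_L2D f g : \pi_L2 (f + g) = \pi_L2 f + \pi_L2 g.
Proof. exact: (Quotient.pi_add L2null f g). Qed.

Fact L2scaleA a b u : L2scale a (L2scale b u) = L2scale (a * b) u.
Proof. by elim/quotW: u => u; rewrite -[L2scale b _]pi_L2Z -!pi_L2Z scalerA. Qed.

Fact L2scale1 : left_id 1 L2scale.
Proof. by move=> u; rewrite /L2scale scale1r reprK. Qed.

Fact L2scaleDr : right_distributive L2scale +%R.
Proof.
move=> a u v; elim/quotW: u => u; elim/quotW: v => v.
by rewrite -pi_L2D -!pi_L2Z -pi_L2D scalerDr.
Qed.

Fact L2scaleDl u : {morph L2scale^~ u : a b / a + b}.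
Proof. by move=> a b; elim/quotW: u => u; rewrite -!pi_L2Z -pi_L2D scalerDl. Qed.

HB.instance Definition _ := GRing.Zmodule_isLmodule.Build R[i] L2
  L2scaleA L2scale1 L2scaleDr L2scaleDl.

(* An arbitrary representative of the class *)
Definition L2_to_fun (u : L2) : 'rV[R]_N -> 'cV[R[i]]_M := L2fun_val (repr u).

Definition L2norm (u : L2) : R :=
  Num.sqrt (\int[mu]_(k in cube R N) sqnorm_cV (L2_to_fun u k)).

(* The class of u if u is square integrable. The value 0 otherwise only makes
   this total: a product or a partial average with continuous coefficients is
   square integrable whenever the argument is. *)
Definition L2class (u : 'rV[R]_N -> 'cV[R[i]]_M) : L2 := \pi_L2 (insubd 0 u).

End L2.
Coercion L2_to_fun : L2 >-> Funclass.

Section operators.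
Variable R : realType.

Definition cube_integral n (f : 'rV[R]_n -> R[i]) : R[i] :=
  (\int[lebesgue_rV R n]_(x in cube R n) complex.Re (f x)) +i*
  (\int[lebesgue_rV R n]_(x in cube R n) complex.Im (f x)).

(* (x_1, ..., x_j, k_(j+1), ..., k_N) *)
Definition splice N j (x : 'rV[R]_j) (k : 'rV[R]_N) : 'rV[R]_N :=
  \row_i (if insub (i : nat) is Some i' then x ord0 i' else k ord0 i).

Definition partial_avg N j m n (F : 'rV[R]_N -> 'M[R[i]]_(m, n))
    (k : 'rV[R]_N) : 'M[R[i]]_(m, n) :=
  \matrix_(a, b) cube_integral (fun x : 'rV[R]_j => F (splice x k) a b).

Section L2_operators.
Variables N M : nat.

Definition bounded_operator (T : L2 R N M -> L2 R N M) : Prop :=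
  linear T /\ exists c : R, forall u, L2norm (T u) <= c * L2norm u.

Definition inverse_operator (T S : L2 R N M -> L2 R N M) : Prop :=
  T \o S = id /\ S \o T = id.

Definition Inv (H : set (L2 R N M -> L2 R N M)) : set (L2 R N M -> L2 R N M) :=
  [set T | [/\ H T, bounded_operator T &
            exists2 S, bounded_operator S & inverse_operator T S]].

Definition is_operator_group (G : set (L2 R N M -> L2 R N M)) : Prop :=
  [/\ G id, forall T S, G T -> G S -> G (T \o S) &
      forall T, G T -> exists2 S, G S & inverse_operator T S].

Definition mul_op (A : 'rV[R]_N -> 'M[R[i]]_M) : L2 R N M -> L2 R N M :=
  fun u => L2class (fun k => A k *m u k).

Definition avg_op j M' (A : 'rV[R]_N -> 'M[R[i]]_(M, M'))
    (B : 'rV[R]_N -> 'M[R[i]]_(M', M)) : L2 R N M -> L2 R N M :=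
  fun u => L2class (fun k => A k *m partial_avg j (fun q => B q *m u q) k).

End L2_operators.

Definition calH N M (j : nat) : set (L2 R N M -> L2 R N M) :=
  if j is 0 then
    [set T | exists2 A : 'rV[R]_N -> 'M[R[i]]_M,
       {within cube R N, continuous A} & T = mul_op A]
  else
    [set T | exists M' (A : 'rV[R]_N -> 'M[R[i]]_(M, M'))
                       (B : 'rV[R]_N -> 'M[R[i]]_(M', M)),
       [/\ (0 < M')%N, {within cube R N, continuous A},
           {within cube R N, continuous B} & T = avg_op j A B]].

Definition calF N M (j : nat) : set (L2 R N M -> L2 R N M) :=
  if j is 0 then Inv (calH 0) else Inv [set id \+ T | T in calH j].

End operators.
Arguments calH R N M j : clear implicits.
Arguments calF R N M j : clear implicits.

(* Main.v *)
(* Everything rests on the fact that the averages < . >_j are constant in the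
   first j variables, so that A1 <B1 A2 <B2 u>> = A1 <B1 A2> <B2 u>.  Hence the
   operators I + A <B .> are closed under composition (concatenate the blocks A
   and stack the blocks B), and, with D = I + <B A>, the operator
   I - A D^-1 <B .> is a two-sided inverse as soon as det D vanishes nowhere;
   D^-1 is then continuous.

   Conversely, suppose that D(k0) v = 0 with v <> 0, and let f be v times the
   indicator of a small neighbourhood of k0 in the last N - j variables.  Then
   |D f| <= eps |f|, and T = I + A <B .> satisfies T (A f) = A D f, so if T has
   a bounded inverse then |A f| = O(eps |f|).  But f = D f - <B A f>, whence
   |f| = O(eps |f|), which is absurd for eps small.

   The group F_0 is the case j = 0 of the same statements: < . >_0 is the
   identity, and multiplication by A is I + (A - I) <I .>_0.

   The analytic input is that f |-> <f>_j is a well defined contraction of L2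
   (Tonelli and Cauchy-Schwarz on slices) that preserves continuity. *)
Require Import Defs.
From HB Require Import structures.
From mathcomp Require Import all_boot all_order all_algebra.
From mathcomp Require Import complex.
From mathcomp Require Import all_classical all_reals all_analysis.
From mathcomp Require Import ring_quotient ring lra measurable_realfun.
Set Implicit Arguments. Unset Strict Implicit. Unset Printing Implicit Defensive.
Import Order.TTheory GRing.Theory Num.Theory.
Import numFieldNormedType.Exports.
Local Open Scope classical_set_scope.
Local Open Scope ring_scope.
Local Open Scope complex_scope.

(** * Lebesgue measure on a product of cubes *)

(** The determinant of D may vanish at a single [k0], that is on a null set, so an exact kernel
    element need not exist in L2; this is why the converse works with approximate kernels and uses
    the bound on the inverse. Moreover D acts on vectors of length M' while the operator acts on
    vectors of length M, and A f may be tiny or zero. Smallness of T (A f) is therefore no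
    contradiction by itself: the estimate has to be closed on f, whose independence of the first j
    variables gives <B A f> = <B A> f.

    The other obstacle is that elements of L2 are classes with an arbitrary representative, while <
    . >_j reads values along slices, which are null sets when j < N. A slice of a square integrable
    function may fail to be integrable, and averages need not add up there. The algebra is thus done
    on functions, with identities valid for almost every k, and only then passed to classes. Bounds
    are for squared norms and deliberately crude: any finite constant will do, since eps is chosen
    after all the others. *)

Section lebesgue_rV_product.
Variable R : realType.

Lemma measurable_row_mx j n :
  measurable_fun setT (fun p : 'rV[R]_j * 'rV[R]_n => row_mx p.1 p.2).
Proof.
apply: measurable_rVP => i; case: (split_ordP i) => i' ->.
  under eq_fun do rewrite row_mxEl.
  exact: (measurableT_comp (measurable_rV_coord i')).
under eq_fun do rewrite row_mxEr.
exact: (measurableT_comp (measurable_rV_coord i')).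
Qed.

Lemma integral_lebesgue_rVS n (f : 'rV[R]_n.+1 -> \bar R) :
  measurable_fun setT f -> (forall x, 0 <= f x)%E ->
  (\int[lebesgue_rV R n.+1]_x f x =
   \int[lebesgue_measure]_a \int[lebesgue_rV R n]_x f (cons_rV (a, x)))%E.
Proof.
move=> mf f0.
have -> : (\int[lebesgue_rV R n.+1]_x f x =
    \int[lebesgue_measure \x lebesgue_rV R n]_p (f \o @cons_rV R n) p)%E.
  rewrite -[RHS](@ge0_integral_pushforward _ _ _ _ _ _ (@measurable_cons_rV R n)
    (lebesgue_measure \x lebesgue_rV R n)%E setT f)//.
rewrite fubini_tonelli1//; last by move=> p; exact: f0.
by apply: measurableT_comp => //; exact: measurable_cons_rV.
Qed.

(** Well typed because [j.+1 + n] and [(j + n).+1] are convertible; the ordinals built by [lshift],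
    [rshift] and [lift] still differ as terms and are compared by value. *)
Lemma row_mx_cons j n a (x : 'rV[R]_j) (z : 'rV[R]_n) :
  cons_rV (a, row_mx x z) = row_mx (cons_rV (a, x)) z :> 'rV[R]_(j.+1 + n).
Proof.
have shift (i : 'I_(j.+1 + n)) (i' : 'I_(j + n)) : i = i'.+1 :> nat ->
    cons_rV (a, row_mx x z) ord0 i = row_mx x z ord0 i'.
  move=> ii'; rewrite -(cons_rVS (a, row_mx x z)); congr (cons_rV _ _ _).
  by apply: val_inj; rewrite /= ii'.
apply/rowP => i; case: (split_ordP i) => i' ->.
  rewrite (row_mxEl (cons_rV (a, x))); case: (unliftP ord0 i') => [i''|] ->.
    by rewrite cons_rVS (shift _ (lshift n i''))// row_mxEl.
  rewrite cons_rV0; transitivity (cons_rV (a, row_mx x z) ord0 ord0).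
    by congr (cons_rV _ _ _); exact: val_inj.
  by rewrite cons_rV0.
by rewrite (row_mxEr (cons_rV (a, x))) (shift _ (rshift j i'))// row_mxEr.
Qed.

(** Induction on [j]: [lebesgue_rV] splits off the first coordinate, so each step only has to move
    that one integral past the integral over [z]. *)
Lemma tonelli_row_mx j n (f : 'rV[R]_(j + n) -> \bar R) :
  measurable_fun setT f -> (forall x, 0 <= f x)%E ->
  (\int[lebesgue_rV R (j + n)]_k f k =
   \int[lebesgue_rV R n]_z \int[lebesgue_rV R j]_x f (row_mx x z))%E.
Proof.
have mrow i (g : 'rV[R]_(i + n) -> \bar R) : measurable_fun setT g ->
    measurable_fun setT (fun p : 'rV[R]_i * 'rV[R]_n => g (row_mx p.1 p.2)).
  by move=> mg; apply: measurableT_comp => //; exact: measurable_row_mx.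
elim: j f => [|j IHj] f mf f0.
  (* [lebesgue_rV R 0] is the Dirac mass at the empty row. *)
  apply: eq_integral => z _; rewrite integral_dirac//=; last first.
    apply: (measurableT_comp (mrow 0%N f mf) (g := fun x => (x, z))); exact: measurable_fun_pair.
  rewrite diracE mem_set// mul1e; congr f; apply/rowP => i.
  have E : i = rshift 0 i :> 'I_(0 + n) by exact: val_inj.
  by rewrite [in RHS]E row_mxEr; congr (z _ _); rewrite ord1.
rewrite -[(j.+1 + n)%N]/((j + n).+1) in f mf f0 *.
rewrite integral_lebesgue_rVS//.
have mfc : measurable_fun setT (fun p => f (@cons_rV R (j + n) p)).
  by apply: measurableT_comp => //; exact: measurable_cons_rV.
under eq_integral => a _.
  rewrite (IHj (fun x => f (cons_rV (a, x))))//; last first.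
    by apply: (measurableT_comp mfc (g := fun x => (a, x))); exact: measurable_fun_pair.
  over.
pose g (p : measurableTypeR R * 'rV[R]_n) :=
  (\int[lebesgue_rV R j]_x f (cons_rV (p.1, row_mx x p.2)))%E.
rewrite (@fubini_tonelli _ _ _ _ _ lebesgue_measure (lebesgue_rV R n) g); last 2 first.
(* [g] is a partial integral of [h], which gives its joint measurability in [(a, z)]. *)
- pose h (q : (measurableTypeR R * 'rV[R]_n) * 'rV[R]_j) :=
    f (cons_rV (q.1.1, row_mx q.2 q.1.2)).
  apply: (@measurable_fun_fubini_tonelli_F _ _ _ _ _ (lebesgue_rV R j) h) => //;
  last by move=> q; exact: f0.
  apply: (measurableT_comp mfc (g := fun q => (q.1.1, row_mx q.2 q.1.2))).
  apply: measurable_fun_pair; first exact: measurableT_comp.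
  apply: (measurableT_comp (@measurable_row_mx j n) (g := fun q => (q.2, q.1.2))).
  by apply: measurable_fun_pair => //; exact: measurableT_comp.
- by move=> p; apply: integral_ge0 => x _; exact: f0.
apply: eq_integral => z _; rewrite integral_lebesgue_rVS//; last first.
  by apply: (measurableT_comp (mrow j.+1 f mf) (g := fun x => (x, z))); exact: measurable_fun_pair.
by apply: eq_integral => a _; apply: eq_integral => x _; rewrite /= row_mx_cons.
Qed.

Lemma cube_row_mx j n (x : 'rV[R]_j) (z : 'rV[R]_n) :
  cube R (j + n) (row_mx x z) <-> cube R j x /\ cube R n z.
Proof.
split=> [c|[cx cz] i].
  split=> i; first by have := c (lshift n i); rewrite row_mxEl.
  by have := c (rshift j i); rewrite row_mxEr.
by case: (split_ordP i) => i' ->; rewrite ?row_mxEl ?row_mxEr.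
Qed.

Lemma splice_row_mx j n (x y : 'rV[R]_j) (z : 'rV[R]_n) :
  splice x (row_mx y z) = row_mx x z.
Proof.
apply/rowP => i; rewrite mxE; case: (split_ordP i) => i' ->.
  rewrite [RHS]row_mxEl (valK i' : insub (lshift n i' : nat) = Some i') /=.
  by congr (x _ _); rewrite ord1.
rewrite insubF/=; last by rewrite ltnNge leq_addr.
by rewrite !row_mxEr; congr (z _ _); rewrite ord1.
Qed.

Lemma spliceK N j (x y : 'rV[R]_j) (k : 'rV[R]_N) :
  splice x (splice y k) = splice x k.
Proof. by apply/rowP => i; rewrite !mxE; case: insubP => //; rewrite mxE; case: insubP. Qed.

Lemma cube_splice N j (x : 'rV[R]_j) (k : 'rV[R]_N) :
  cube R j x -> cube R N k -> cube R N (splice x k).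
Proof. by move=> cx ck i; rewrite mxE; case: insubP. Qed.

Lemma measurable_splicel N j (k : 'rV[R]_N) :
  measurable_fun setT (fun x : 'rV[R]_j => splice x k).
Proof.
apply: measurable_rVP => i; under eq_fun do rewrite mxE.
by case: insubP => [i' _ _|_]; [exact: measurable_rV_coord|exact: measurable_cst].
Qed.

Lemma measurable_splice N j :
  measurable_fun setT (fun p : 'rV[R]_j * 'rV[R]_N => splice p.1 p.2).
Proof.
apply: measurable_rVP => i; under eq_fun do rewrite mxE.
case: insubP => [i' _ _|_].
  exact: (measurableT_comp (measurable_rV_coord i') (g := fst)).
exact: (measurableT_comp (measurable_rV_coord i) (g := snd)).
Qed.

(* Integrating over [0,1]^N the average over the first j coordinates gives back
   the integral: the extra integration is over a cube of measure 1. *)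
Lemma tonelli_splice N j (F : 'rV[R]_N -> \bar R) : (j <= N)%N ->
  measurable_fun (cube R N) F -> (forall k, cube R N k -> 0 <= F k)%E ->
  measurable_fun (cube R N)
    (fun k => \int[lebesgue_rV R j]_(x in cube R j) F (splice x k))%E /\
  (\int[lebesgue_rV R N]_(k in cube R N)
     \int[lebesgue_rV R j]_(x in cube R j) F (splice x k) =
   \int[lebesgue_rV R N]_(k in cube R N) F k)%E.
Proof.
move=> jN mF F0; have [n NE] : exists n, N = (j + n)%N by exists (N - j)%N; rewrite subnKC.
subst N; set N := (j + n)%N in F mF F0 *.
have mcj := measurable_cube R j; have mcN := measurable_cube R N.
(* Extension by zero, so that Tonelli on the whole space applies. *)
pose G := F \_ (cube R N).
have mG : measurable_fun setT G by apply/(measurable_restrictT F).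
have G0 k : (0 <= G k)%E by rewrite /G patchE; case: ifPn => // /set_mem /F0.
have inner k : cube R N k ->
    (\int[lebesgue_rV R j]_(x in cube R j) F (splice x k) =
     \int[lebesgue_rV R j]_(x in cube R j) G (splice x k))%E.
  move=> ck; apply: eq_integral => x /set_mem cx.
  by rewrite /G patchE mem_set//; exact: cube_splice.
pose Phi k := (\int[lebesgue_rV R j]_(x in cube R j) G (splice x k))%E.
have mPhi : measurable_fun setT Phi.
  pose h (p : 'rV[R]_N * 'rV[R]_j) := ((fun p => G (splice p.2 p.1)) \_ (setT `*` cube R j)) p.
  have -> : Phi = fun k => (\int[lebesgue_rV R j]_x h (k, x))%E.
    apply/funext => k; rewrite /Phi integral_mkcond; apply: eq_integral => x _.
    by rewrite /h !patchE in_setX in_setT.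
  apply: measurable_fun_fubini_tonelli_F.
    apply/(measurable_restrictT (fun p => G (splice p.2 p.1))); first exact: measurableX.
    apply: measurable_funS measurableT _ _ => //.
    apply: (measurableT_comp mG).
    apply: (measurableT_comp (@measurable_splice N j) (g := fun p => (p.2, p.1))).
    exact: measurable_fun_pair.
  by move=> p; rewrite /h patchE; case: ifP.
have Phi0 k : (0 <= Phi k)%E by apply: integral_ge0 => x _; exact: G0.
split.
  apply: (eq_measurable_fun Phi); first by move=> k /set_mem ck; rewrite inner.
  exact: measurable_funS measurableT _ mPhi.
under eq_integral => k /set_mem ck do rewrite inner//.
rewrite integral_mkcond [RHS]integral_mkcond -/G.
rewrite /N !tonelli_row_mx//; last 2 first.
- by apply/(measurable_restrictT Phi) => //; exact: measurable_funS measurableT _ mPhi.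
- by move=> k; rewrite patchE; case: ifP => // _; exact: Phi0.
apply: eq_integral => z _.
have [cz|ncz] := pselect (cube R n z); last first.
  rewrite !integral0_eq// => x _; rewrite /G patchE memNset// => /cube_row_mx[_];
    exact: ncz.
(* [splice] overwrites the first block, so on the slice over [z] the function [Phi] is the constant
   [Phi (row_mx 0 z)]. *)
transitivity (\int[lebesgue_rV R j]_(x in cube R j) cst (Phi (row_mx 0 z)) x)%E.
  rewrite [RHS]integral_mkcond; apply: eq_integral => x _; rewrite !patchE.
  case: (pselect (cube R j x)) => cx; last first.
    by rewrite !memNset// => /cube_row_mx[/cx].
  rewrite !mem_set//; last exact/cube_row_mx.
  by rewrite /Phi /=; apply: eq_integral => y _; rewrite !splice_row_mx.
rewrite (integral_cst (lebesgue_rV R j) mcj) [X in (_ * X)%E](@lebesgue_cube R j) mule1.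
rewrite /Phi integral_mkcond.
apply: eq_integral => x _; rewrite patchE splice_row_mx; case: ifPn => // ncx.
by rewrite /G patchE memNset// => /cube_row_mx[cx]; move: ncx; rewrite mem_set.
Qed.

End lebesgue_rV_product.

(** * Continuous functions on the cube *)

Section continuity_on_cube.
Variable R : realType.

(** Balls of row vectors are coordinatewise. The explicit form suits splices and boxes, which are
    checked one coordinate at a time. *)
Lemma cube_continuousP N (g : 'rV[R]_N -> R) :
  {within cube R N, continuous g} <->
  forall k, cube R N k -> forall e : R, 0 < e -> exists2 d : R, 0 < d &
    forall k', cube R N k' -> (forall i, `|k ord0 i - k' ord0 i| < d) -> `|g k - g k'| < e.
Proof.
rewrite subspace_continuousP; split => [gc k ck e e0|gc k ck].
  have /cvgrPdist_lt /(_ e e0) := gc k ck.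
  rewrite near_withinE => /nbhs_ballP[d /= d0 kd]; exists d => // k' ck' kk'.
  by apply: kd => //; split => // i j; rewrite !ord1; exact: kk'.
apply/cvgrPdist_lt => e e0; have [d d0 kd] := gc k ck e e0.
rewrite near_withinE; apply/nbhs_ballP; exists d => //= k' [_ kk'] ck'.
by apply: kd => // i; exact: kk'.
Qed.

(** Both [|Re z|] and [|Im z|] are at most [|z|], which is at most their sum. *)
Lemma cube_continuous_mxP N m n (A : 'rV[R]_N -> 'M[R[i]]_(m, n)) :
  {within cube R N, continuous A} <->
  forall a b, {within cube R N, continuous (fun k => complex.Re (A k a b))} /\
              {within cube R N, continuous (fun k => complex.Im (A k a b))}.
Proof.
split => [/subspace_continuousP Ac a b|Ac].
  suff H k : cube R N k -> forall e : R, 0 < e -> exists2 d : R, 0 < d &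
    forall k', cube R N k' -> (forall i, `|k ord0 i - k' ord0 i| < d) ->
    `|A k a b - A k' a b| < e%:C.
    split; apply/cube_continuousP => k ck e e0; have [d d0 kd] := H k ck e e0;
      exists d => // k' ck' kk'; have := kd k' ck' kk';
      rewrite normc_def ltcR; apply: le_lt_trans.
      by rewrite -sqrtr_sqr ler_wsqrtr// !raddfB lerDl sqr_ge0.
    by rewrite -sqrtr_sqr ler_wsqrtr// !raddfB lerDr sqr_ge0.
  move=> ck e e0.
  have /cvg_ballP /(_ e%:C) := Ac k ck; rewrite ltcR => /(_ e0).
  rewrite near_withinE => /nbhs_ballP[d /= d0 kd]; exists d => // k' ck' kk'.
  have [] := kd k' _ ck'; last by move=> _ /(_ a b).
  by split => // i j; rewrite !ord1; exact: kk'.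
apply/subspace_continuousP => k ck; apply/cvg_ballP => e e0.
(* Radii are taken in [R[i]], whose order makes every positive element real. *)
have [r r0 ->] : exists2 r : R, 0 < r & e = r%:C.
  by move: e0; case: e => r s; rewrite ltcE/= => /andP[/eqP -> r0]; exists r.
have nbr (a : 'I_m) : \forall k' \near within (cube R N) (nbhs k),
    forall b : 'I_n, ball (A k a b) r%:C (A k' a b).
  apply: filter_forall => b; have [/subspace_continuousP rc /subspace_continuousP ic] := Ac a b.
  have /cvgrPdist_lt /(_ (r / 2)) := rc k ck; rewrite divr_gt0// => /(_ isT).
  have /cvgrPdist_lt /(_ (r / 2)) := ic k ck; rewrite divr_gt0// => /(_ isT).
  apply: filterS2 => k' ik rk.
  change (`|A k a b - A k' a b| < r%:C); rewrite normc_def ltcR !raddfB/=.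
  set x := complex.Re _ - _ in rk *; set y := complex.Im _ - _ in ik *.
  have xy : `|x| + `|y| < r by lra.
  clearbody x y.
  apply: le_lt_trans xy.
  rewrite -[leRHS]ger0_norm ?addr_ge0// -sqrtr_sqr ler_wsqrtr//.
  rewrite sqrrD !real_normK ?num_real// lerD2r lerDl.
  by rewrite mulrn_wge0// mulr_ge0.
have FF : Filter (within (cube R N) (nbhs k)) by exact: within_filter.
apply: (@filterS _ _ FF _ _ _ (filter_forall FF nbr)) => k' kk' /=.
by split; [rewrite ltcR|move=> a b; exact: kk'].
Qed.

(** The sigma-algebra on rows is generated by the coordinates, so openness has to be turned into a
    countable union: on the cube, [a < g] holds exactly on the union of the rational boxes
    throughout which it holds. *)
Lemma cube_continuous_measurable N (g : 'rV[R]_N -> R) :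
  {within cube R N, continuous g} -> measurable_fun (cube R N) g.
Proof.
move=> /cube_continuousP gc; have mc := measurable_cube R N.
apply: (measurability _ (RGenOInfty.measurableE R)) => _ [_ [a ->] <-].
(* Rational centre and half-side [1 / (m + 1)]: such pairs are countable, and their [pickle] codes
   index the union. *)
pose box (q : {ffun 'I_N -> rat} * nat) := [set k : 'rV[R]_N |
  forall i, `|k ord0 i - ratr (q.1 i)| < q.2.+1%:R^-1].
pose good q := forall k, cube R N k -> box q k -> a < g k.
have mbox q : measurable (box q).
  have -> : box q = \bigcap_(i in [set: 'I_N])
      ((fun k : 'rV[R]_N => k ord0 i) @^-1`
         `]ratr (q.1 i) - q.2.+1%:R^-1, ratr (q.1 i) + q.2.+1%:R^-1[).
    apply/seteqP; split => [k kq i _|k kq i] /=.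
      by have := kq i; rewrite ltr_distl in_itv.
    by have := kq i I; rewrite ltr_distl /= in_itv.
  apply: fin_bigcap_measurable => // i _; rewrite -[X in measurable X]setTI.
  exact: measurable_rV_coord.
rewrite (_ : _ `&` _ = cube R N `&` \bigcup_n
    (if unpickle n is Some q then (if `[< good q >] then box q else set0) else set0)).
  apply: measurableI => //; apply: bigcupT_measurable => n.
  by case: (unpickle n) => [q|//]; case: ifP.
apply/seteqP; split => k [ck]; last first.
  case=> n _; case: (unpickle n) => [q|//]; case: asboolP => // gq qk.
  by split => //=; rewrite in_itv/= andbT; exact: gq.
rewrite /= in_itv/= andbT => agk; split => //.
have [d d0 kd] := gc k ck (g k - a) ltac:(by rewrite subr_gt0).
(* [k] will lie within [1 / (m + 1)] of the centre of its box, so a half-side below [d / 2] keeps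
   the box within [d] of [k]. *)
have [m md] : exists m : nat, m.+1%:R^-1 < d / 2.
  have [m] := @ltr_add_invr R 0 (d / 2) ltac:(by rewrite divr_gt0).
  by rewrite add0r; exists m.
have pex i : exists q : rat, `|k ord0 i - ratr q| < m.+1%:R^-1.
  have [q] := @rat_in_itvoo R (k ord0 i - m.+1%:R^-1) (k ord0 i + m.+1%:R^-1) ltac:(
    by rewrite ltrD2l gtrN// invr_gt0).
  rewrite in_itv/= => /andP[q1 q2]; exists q; rewrite ltr_norml.
  by move: m.+1%:R^-1 q1 q2 => u q1 q2; apply/andP; split; lra.
have [p pk] := choice pex.
exists (pickle ([ffun i => p i], m)) => //; rewrite pickleK ifT; last first.
  apply/asboolP => k' ck' k'p.
  have /(kd _ ck') : forall i, `|k ord0 i - k' ord0 i| < d.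
    move=> i; have := k'p i; have := pk i; rewrite /= ffunE !ltr_norml.
    by move: m.+1%:R^-1 md => u md /andP[? ?] /andP[? ?]; apply/andP; split; lra.
  by rewrite ltr_norml => /andP[? ?]; lra.
by move=> i; rewrite ffunE.
Qed.

Lemma compact_cube N : compact (cube R N).
Proof.
have := @rV_compact R N (fun=> [set` `[0 : R, 1]]) (fun=> @segment_compact R 0 1).
congr compact; apply/seteqP; split => x /= xc i; have := xc i; by rewrite in_itv.
Qed.

Lemma cube_continuous_bounded N (g : 'rV[R]_N -> R) :
  {within cube R N, continuous g} ->
  exists2 C, 0 <= C & forall k, cube R N k -> `|g k| <= C.
Proof.
move=> gc; have /compact_bounded[C [Cr gC]] := continuous_compact gc (@compact_cube N).
exists (`|C| + 1) => [|k ck]; first by rewrite addr_ge0.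
by apply: (gC (`|C| + 1)); [rewrite (le_lt_trans (ler_norm C))// ltrDl|exists k].
Qed.

Definition avgr N j (g : 'rV[R]_N -> R) (k : 'rV[R]_N) : R :=
  \int[lebesgue_rV R j]_(x in cube R j) g (splice x k).

(* Compactness of [0,1]^j makes the continuity of g in k uniform along the slice. *)
Lemma cube_continuous_slice N j (g : 'rV[R]_N -> R) k :
  {within cube R N, continuous g} -> cube R N k -> forall e : R, 0 < e ->
  exists2 d : R, 0 < d & forall k', cube R N k' -> (forall i, `|k ord0 i - k' ord0 i| < d) ->
    forall x : 'rV[R]_j, cube R j x -> `|g (splice x k) - g (splice x k')| < e.
Proof.
move=> /cube_continuousP gc ck e e0.
have /compact_near_coveringP cpt := @compact_cube j.
have near_k : \forall k' \near k, forall x, cube R j x -> cube R j x -> cube R N k' ->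
    `|g (splice x k) - g (splice x k')| < e.
  apply: (cpt 'rV[R]_N (nbhs k) (fun k' x => cube R j x -> cube R N k' ->
     `|g (splice x k) - g (splice x k')| < e) (nbhs_filter k)) => x cx.
  have [d d0 gd] := gc _ (cube_splice cx ck) (e / 2) ltac:(by rewrite divr_gt0).
  exists (ball x d, ball k d) => /=.
    by split; apply/nbhs_ballP; exists d.
  move=> [x' k'] /= [[_ xx'] [_ kk']] cx' ck'.
  (* Both values on the slice over [x'] are compared with the value at the centre [splice x k], at a
     cost of [e / 2] each. *)
  have h1 : `|g (splice x k) - g (splice x' k)| < e / 2.
    apply: gd => [|i]; first exact: cube_splice.
    by rewrite !mxE; case: insubP => [i' _ _|_]; [exact: xx'|rewrite subrr normr0].
  have h2 : `|g (splice x k) - g (splice x' k')| < e / 2.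
    apply: gd => [|i]; first exact: cube_splice.
    by rewrite !mxE; case: insubP => [i' _ _|_]; [exact: xx'|exact: kk'].
  move: h1 h2; rewrite !ltr_norml => /andP[? ?] /andP[? ?].
  by apply/andP; split; lra.
have /nbhs_ballP[d /= d0 kd] := near_k.
exists d => // k' ck' kk' x cx; apply: kd => //.
by split => // a b; rewrite !ord1; exact: kk'.
Qed.

Lemma cube_continuous_splice N j (g : 'rV[R]_N -> R) k :
  {within cube R N, continuous g} -> cube R N k ->
  {within cube R j, continuous (fun x => g (splice x k))}.
Proof.
move=> /cube_continuousP gc ck; apply/cube_continuousP => x cx e e0.
have [d d0 gd] := gc _ (cube_splice cx ck) e e0.
exists d => // x' cx' xx'; apply: gd => [|i]; first exact: cube_splice.
by rewrite !mxE; case: insubP => [i' _ _|_] //; rewrite subrr normr0.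
Qed.

Lemma cube_continuous_integrable N (g : 'rV[R]_N -> R) :
  {within cube R N, continuous g} ->
  (lebesgue_rV R N).-integrable (cube R N) (EFin \o g).
Proof.
move=> gc; have [C C0 gC] := cube_continuous_bounded gc.
apply: measurable_bounded_integrable.
- exact: measurable_cube.
- by rewrite [ltLHS](@lebesgue_cube R N) ltry.
- exact: cube_continuous_measurable.
- exists C; split; first exact: num_real.
  by move=> x Cx k ck; apply: le_trans (ltW Cx); exact: gC.
Qed.

Lemma Rintegral_cube_cst j (c : R) :
  \int[lebesgue_rV R j]_(x in cube R j) c = c.
Proof.
rewrite Rintegral_cst; last exact: measurable_cube.
by rewrite [X in fine X](@lebesgue_cube R j) mulr1.
Qed.

(** The modulus from [cube_continuous_slice] does not depend on [x], so it survives integration over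
    a cube of measure 1. *)
Lemma cube_continuous_avgr N j (g : 'rV[R]_N -> R) :
  {within cube R N, continuous g} -> {within cube R N, continuous (avgr j g)}.
Proof.
move=> gc; apply/cube_continuousP => k ck e e0.
have [d d0 gd] := cube_continuous_slice j gc ck (e := e / 2) ltac:(by rewrite divr_gt0).
have mcj := measurable_cube R j.
have gI k' : cube R N k' -> (lebesgue_rV R j).-integrable (cube R j)
    (EFin \o (fun x => g (splice x k'))).
  by move=> ck'; apply: cube_continuous_integrable; exact: cube_continuous_splice.
exists d => // k' ck' kk'.
rewrite /avgr -RintegralB//; [|exact: gI|exact: gI].
have gBI := integrableB mcj (gI k ck) (gI k' ck').
apply: le_lt_trans (le_normr_Rintegral mcj gBI) _.
(* Integration preserves only the weak inequality; starting from [e / 2] restores the strict one. *)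
apply: le_lt_trans (_ : e / 2 < e); last by lra.
rewrite -[leRHS](Rintegral_cube_cst j); apply: le_Rintegral => //.
- exact: integrable_norm.
- by apply: cube_continuous_integrable => x; exact: cvg_cst.
- by move=> x cx; apply: ltW; exact: gd.
Qed.

End continuity_on_cube.

(** * Averages of square integrable functions *)

Section real_square_integrable.
Variable R : realType.
Local Notation mu N := (lebesgue_rV R N).

Definition L2r N (g : 'rV[R]_N -> R) : Prop :=
  measurable_fun (cube R N) g /\
  (\int[mu N]_(k in cube R N) ((g k) ^+ 2)%:E < +oo)%E.

Lemma eq_L2r N (f g : 'rV[R]_N -> R) :
  {in cube R N, f =1 g} -> L2r f -> L2r g.
Proof.
move=> fg [mf f2]; split; first exact: eq_measurable_fun mf.
by rewrite (eq_integral (fun k => (f k ^+ 2)%:E))// => k kc; rewrite fg.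
Qed.

(** A single domination criterion for sums ([a = b = 2]) and for bounded multipliers ([a = C ^ 2],
    [b = 0]). *)
Lemma L2r_le N (f g : 'rV[R]_N -> R) (h : 'rV[R]_N -> R) (a b : R) :
  0 <= a -> 0 <= b -> measurable_fun (cube R N) h -> L2r f -> L2r g ->
  (forall k, cube R N k -> h k ^+ 2 <= a * f k ^+ 2 + b * g k ^+ 2) -> L2r h.
Proof.
move=> a0 b0 mh [mf f2] [mg g2] hfg; split => //.
have mcN := measurable_cube R N.
have m1 : measurable_fun (cube R N) (fun k => (a * f k ^+ 2)%:E).
  by apply/measurable_EFinP/measurable_funM => //; exact: measurable_funX.
have m2 : measurable_fun (cube R N) (fun k => (b * g k ^+ 2)%:E).
  by apply/measurable_EFinP/measurable_funM => //; exact: measurable_funX.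
apply: (@le_lt_trans _ _ (\int[mu N]_(k in cube R N)
   ((a * f k ^+ 2)%:E + (b * g k ^+ 2)%:E))%E).
  apply: ge0_le_integral => //.
  - by move=> k _; rewrite lee_fin sqr_ge0.
  - by apply/measurable_EFinP; exact: measurable_funX.
  - exact: emeasurable_funD.
rewrite ge0_integralD//; last 2 first.
  - by move=> k _; rewrite lee_fin mulr_ge0// sqr_ge0.
  - by move=> k _; rewrite lee_fin mulr_ge0// sqr_ge0.
under eq_integral do rewrite EFinM.
under [X in (_ + X)%E]eq_integral do rewrite EFinM.
rewrite !ge0_integralZl//; last 4 first.
- by apply/measurable_EFinP; exact: measurable_funX.
- by move=> k _; rewrite lee_fin sqr_ge0.
- by apply/measurable_EFinP; exact: measurable_funX.
- by move=> k _; rewrite lee_fin sqr_ge0.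
by rewrite lte_add_pinfty// lte_mul_pinfty.
Qed.

Lemma L2rD N (f g : 'rV[R]_N -> R) : L2r f -> L2r g -> L2r (fun k => f k + g k).
Proof.
move=> f2 g2; apply: (@L2r_le _ f g _ 2 2) => //.
  by apply: measurable_funD; [exact: f2.1|exact: g2.1].
by move=> k _; have := sqr_ge0 (f k - g k); nra.
Qed.

Lemma L2rM N (h f : 'rV[R]_N -> R) (C : R) : measurable_fun (cube R N) h ->
  (forall k, cube R N k -> `|h k| <= C) -> L2r f -> L2r (fun k => h k * f k).
Proof.
move=> mh hC f2; apply: (@L2r_le _ f f _ (C ^+ 2) 0) => //; first exact: sqr_ge0.
  by apply: measurable_funM => //; exact: f2.1.
move=> k ck; rewrite mul0r addr0 exprMn ler_wpM2r ?sqr_ge0// -(real_normK (num_real (h k))).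
by rewrite ler_sqr ?hC// nnegrE ?(le_trans _ (hC k ck)).
Qed.

Lemma L2r_continuousM N (h f : 'rV[R]_N -> R) : {within cube R N, continuous h} ->
  L2r f -> L2r (fun k => h k * f k).
Proof.
move=> hc f2; have [C _ hC] := cube_continuous_bounded hc.
by apply: L2rM f2; [exact: cube_continuous_measurable|exact: hC].
Qed.

Lemma L2r_cst N (c : R) : L2r (fun=> c : R) (N := N).
Proof.
split; first exact: measurable_cst.
have mcN := measurable_cube R N.
rewrite (integral_cst (mu N) mcN (c ^+ 2)%:E) [X in (_ * X)%E](@lebesgue_cube R N).
by rewrite mule1 ltry.
Qed.

Lemma L2r_sqr_integrable N (g : 'rV[R]_N -> R) :
  L2r g -> (mu N).-integrable (cube R N) (EFin \o (fun k => g k ^+ 2)).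
Proof.
move=> [mg g2]; apply/integrableP; split.
  by apply/measurable_EFinP; exact: measurable_funX.
rewrite (eq_integral (fun k => (g k ^+ 2)%:E))// => k _.
by rewrite gee0_abs// lee_fin sqr_ge0.
Qed.

(** The cube has finite measure and [|g| <= g ^ 2 + 1]. *)
Lemma L2r_integrable N (g : 'rV[R]_N -> R) :
  L2r g -> (mu N).-integrable (cube R N) (EFin \o g).
Proof.
move=> g2; have mcN := measurable_cube R N.
have gI := integrableD mcN (L2r_sqr_integrable g2) (L2r_sqr_integrable (L2r_cst N 1)).
apply: le_integrable gI => //; first by apply/measurable_EFinP; exact: g2.1.
move=> k _; rewrite [leRHS]/= lee_fin expr1n [leRHS]ger0_norm ?addr_ge0 ?sqr_ge0//.
rewrite -(real_normK (num_real (g k))).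
by have := sqr_ge0 (`|g k| - 1); have := normr_ge0 (g k); nra.
Qed.

(** Cauchy-Schwarz against the constant 1: with [c] the mean of [g], integrate
    [2 c g <= g ^ 2 + c ^ 2]. *)
Lemma sqr_Rintegral_le j (g : 'rV[R]_j -> R) : measurable_fun (cube R j) g ->
  (((\int[mu j]_(x in cube R j) g x) ^+ 2)%:E <=
   \int[mu j]_(x in cube R j) (g x ^+ 2)%:E)%E.
Proof.
move=> mg; have mcj := measurable_cube R j.
(* An infinite right-hand side does occur, on exceptional slices of a square integrable function. *)
have [->|] := eqVneq (\int[mu j]_(x in cube R j) (g x ^+ 2)%:E)%E +oo%E; first exact: leey.
rewrite -ltey => g2; have gL : L2r g by [].
have gI := L2r_integrable gL; have g2I := L2r_sqr_integrable gL.
have g2E : (\int[mu j]_(x in cube R j) (g x ^+ 2)%:E)%E =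
    (\int[mu j]_(x in cube R j) g x ^+ 2)%:E.
  by rewrite fineK// ge0_fin_numE// integral_ge0// => x _; rewrite lee_fin sqr_ge0.
rewrite g2E lee_fin.
set c := \int[mu j]_(x in cube R j) g x.
have cI := L2r_integrable (L2r_cst j (c ^+ 2)).
have : \int[mu j]_(x in cube R j) (2 * c * g x) <=
       \int[mu j]_(x in cube R j) (g x ^+ 2 + c ^+ 2).
  apply: le_Rintegral => //.
  - exact: (integrableZl mcj (2 * c) gI).
  - exact: (integrableD mcj g2I cI).
  - by move=> x _; have := sqr_ge0 (g x - c); nra.
rewrite RintegralZl// RintegralD// Rintegral_cube_cst -/c; nra.
Qed.

(** [sqr_Rintegral_le] holds on every slice; integrating it over the cube with [tonelli_splice]
    makes the average a contraction. *)
Lemma avgr_square_integrable N j (g : 'rV[R]_N -> R) : (j <= N)%N -> L2r g ->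
  L2r (avgr j g) /\
  (\int[mu N]_(k in cube R N) (avgr j g k ^+ 2)%:E <=
   \int[mu N]_(k in cube R N) (g k ^+ 2)%:E)%E.
Proof.
move=> jN [mg g2]; have mcN := measurable_cube R N.
have mEg : measurable_fun (cube R N) (EFin \o g) by exact/measurable_EFinP.
have [mP _] := tonelli_splice jN (measurable_funepos mEg) (fun k _ => funepos_ge0 _ k).
have [mM _] := tonelli_splice jN (measurable_funeneg mEg) (fun k _ => funeneg_ge0 _ k).
have ma : measurable_fun (cube R N) (avgr j g).
  (* [tonelli_splice] concerns nonnegative functions, hence the positive and negative parts; the
     identity holds at every [k], even where both integrals are infinite. *)
  apply: (eq_measurable_fun (fun k => fine
      ((\int[mu j]_(x in cube R j) (EFin \o g)^\+ (splice x k)) -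
       (\int[mu j]_(x in cube R j) (EFin \o g)^\- (splice x k)))%E)).
    move=> k _; rewrite /avgr /Rintegral [in RHS]integralE.
    by congr (fine (_ - _)); apply: eq_integral => x _; rewrite ?funeposE ?funenegE.
  by apply: measurableT_comp => //; exact: emeasurable_funB.
have mg2 : measurable_fun (cube R N) (fun k => (g k ^+ 2)%:E).
  by apply/measurable_EFinP; exact: measurable_funX.
have g20 k : cube R N k -> (0 <= (g k ^+ 2)%:E)%E by rewrite lee_fin sqr_ge0.
have [mS intS] := tonelli_splice jN mg2 g20.
have le2 : (\int[mu N]_(k in cube R N) (avgr j g k ^+ 2)%:E <=
   \int[mu N]_(k in cube R N) (g k ^+ 2)%:E)%E.
  rewrite -intS; apply: ge0_le_integral => //.
  - by move=> k _; rewrite lee_fin sqr_ge0.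
  - by apply/measurable_EFinP; exact: measurable_funX.
  - move=> k ck; apply: sqr_Rintegral_le.
    apply: (measurable_comp mcN _ mg); first by move=> _ [x cx <-]; exact: cube_splice.
    exact: measurable_funS measurableT _ (@measurable_splicel R N j k).
by split => //; split => //; exact: le_lt_trans g2.
Qed.

(** By Tonelli the slice integrals of [g ^ 2] have a finite integral over the cube, so almost all of
    them are finite. Linearity of averages will be available for these [k]. *)
Lemma ae_slice_square_integrable N j (g : 'rV[R]_N -> R) : (j <= N)%N -> L2r g ->
  {ae mu N, forall k, cube R N k -> L2r (fun x : 'rV[R]_j => g (splice x k))}.
Proof.
move=> jN [mg g2]; have mcN := measurable_cube R N.
have mg2 : measurable_fun (cube R N) (fun k => (g k ^+ 2)%:E).
  by apply/measurable_EFinP; exact: measurable_funX.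
have g20 k : cube R N k -> (0 <= (g k ^+ 2)%:E)%E by rewrite lee_fin sqr_ge0.
have [mS intS] := tonelli_splice jN mg2 g20.
have /integrable_ae : (mu N).-integrable (cube R N)
    (fun k => \int[mu j]_(x in cube R j) ((g (splice x k)) ^+ 2)%:E)%E.
  apply/integrableP; split => //; under eq_integral.
    by move=> k _; rewrite gee0_abs ?integral_ge0// => [|x _]; [over|rewrite lee_fin sqr_ge0].
  by rewrite intS.
move=> /(_ mcN); apply: filterS => k + ck => /(_ ck) fk; split.
  apply: (measurable_comp mcN _ mg); first by move=> _ [x cx <-]; exact: cube_splice.
  exact: measurable_funS measurableT _ (@measurable_splicel R N j k).
by rewrite -ge0_fin_numE// integral_ge0// => x _; rewrite lee_fin sqr_ge0.
Qed.

(** Makes averages well defined on classes. Tonelli for [|f - g|] shows that for almost every [k]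
    its slice integral is 0, and then [f] and [g] agree almost everywhere on that slice. *)
Lemma ae_eq_avgr N j (f g : 'rV[R]_N -> R) : (j <= N)%N ->
  measurable_fun (cube R N) f -> measurable_fun (cube R N) g ->
  {ae mu N, forall k, cube R N k -> f k = g k} ->
  {ae mu N, forall k, cube R N k -> avgr j f k = avgr j g k}.
Proof.
move=> jN mf mg fg; have mcN := measurable_cube R N; have mcj := measurable_cube R j.
pose D k := (`|f k - g k|)%:E.
have mD : measurable_fun (cube R N) D.
  by apply/measurable_EFinP; apply: measurableT_comp => //; exact: measurable_funB.
have D0 k : cube R N k -> (0 <= D k)%E by rewrite lee_fin.
have [mS intS] := tonelli_splice jN mD D0.
have : (\int[mu N]_(k in cube R N) D k = 0)%E.
  rewrite (ae_eq_integral (cst 0%E))//; first exact: integral0.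
  by apply: filterS fg => k fgk ck; rewrite /D fgk// subrr normr0.
rewrite -intS => S0.
have : ae_eq (mu N) (cube R N)
    (fun k => \int[mu j]_(x in cube R j) D (splice x k))%E (cst 0%E).
  apply/ae_eq_integral_abs => //; rewrite -[RHS]S0; apply: eq_integral => k _.
  by rewrite gee0_abs// integral_ge0// => x _; rewrite lee_fin.
apply: filterS => k /= + ck => /(_ ck) Sk.
have ms : measurable_fun (cube R j) (fun x : 'rV[R]_j => splice x k).
  exact: measurable_funS measurableT _ (@measurable_splicel R N j k).
have mcomp (h : 'rV[R]_N -> R) : measurable_fun (cube R N) h ->
    measurable_fun (cube R j) (fun x : 'rV[R]_j => h (splice x k)).
  move=> mh; apply: (measurable_comp mcN _ mh) => //.
  by move=> _ [x cx <-]; exact: cube_splice.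
have : ae_eq (mu j) (cube R j) (fun x => D (splice x k)) (cst 0%E).
  apply/ae_eq_integral_abs => //.
    by apply/measurable_EFinP; apply: measurableT_comp => //; apply: measurable_funB; exact: mcomp.
  rewrite -[RHS]Sk; apply: eq_integral => x _.
  by rewrite gee0_abs// lee_fin.
move=> fgk; congr fine; apply: ae_eq_integral => //.
- by apply/measurable_EFinP; exact: mcomp.
- by apply/measurable_EFinP; exact: mcomp.
apply: filterS fgk => x /= + cx => /(_ cx) [] /normr0P.
by rewrite subr_eq0 => /eqP ->.
Qed.

End real_square_integrable.

(** * Complex-valued functions on the cube *)

Section complex_on_cube.
Variable R : realType.
Local Notation mu N := (lebesgue_rV R N).

Lemma complex_ReM (x y : R[i]) :
  complex.Re (x * y) = complex.Re x * complex.Re y - complex.Im x * complex.Im y.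
Proof. by case: x y => [? ?] [? ?]. Qed.

Lemma complex_ImM (x y : R[i]) :
  complex.Im (x * y) = complex.Re x * complex.Im y + complex.Im x * complex.Re y.
Proof. by case: x y => [? ?] [? ?]. Qed.

(** Stated through real and imaginary parts because integrals are taken part by part;
    [cube_continuous_mxP] links it to the topology of matrices. *)
Definition ccontinuous N (f : 'rV[R]_N -> R[i]) : Prop :=
  {within cube R N, continuous (fun k => complex.Re (f k))} /\
  {within cube R N, continuous (fun k => complex.Im (f k))}.

Lemma eq_ccontinuous N (f g : 'rV[R]_N -> R[i]) :
  (forall k, cube R N k -> f k = g k) -> ccontinuous f -> ccontinuous g.
Proof.
by move=> fg [rf jf]; split; [apply: subspace_eq_continuous rf|apply: subspace_eq_continuous jf];
  move=> k /set_mem kc; rewrite /from_subspace /= fg.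
Qed.

Lemma ccontinuous_cst N (c : R[i]) : @ccontinuous N (fun=> c).
Proof. by split => x; exact: cvg_cst. Qed.

Lemma ccontinuousD N (f g : 'rV[R]_N -> R[i]) :
  ccontinuous f -> ccontinuous g -> ccontinuous (fun k => f k + g k).
Proof.
move=> [rf jf] [rg jg]; split => x.
  by under eq_fun do rewrite raddfD; apply: cvgD; [exact: rf|exact: rg].
by under eq_fun do rewrite raddfD; apply: cvgD; [exact: jf|exact: jg].
Qed.

Lemma ccontinuousM N (f g : 'rV[R]_N -> R[i]) :
  ccontinuous f -> ccontinuous g -> ccontinuous (fun k => f k * g k).
Proof.
move=> [rf jf] [rg jg]; split => x.
  under eq_fun do rewrite complex_ReM.
  by apply: cvgB; apply: cvgM; [exact: rf|exact: rg|exact: jf|exact: jg].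
under eq_fun do rewrite complex_ImM.
by apply: cvgD; apply: cvgM; [exact: rf|exact: jg|exact: jf|exact: rg].
Qed.

Lemma ccontinuous_sum N (I : Type) (r : seq I) (P : pred I) (F : I -> 'rV[R]_N -> R[i]) :
  (forall i, ccontinuous (F i)) -> ccontinuous (fun k => \sum_(i <- r | P i) F i k).
Proof.
move=> Fc; elim: r => [|i r IHr].
  by under eq_fun do rewrite big_nil; exact: (@ccontinuous_cst N).
under eq_fun do rewrite big_cons; case: (P i) => //; exact: ccontinuousD (Fc i) IHr.
Qed.

Lemma ccontinuous_prod N (I : Type) (r : seq I) (P : pred I) (F : I -> 'rV[R]_N -> R[i]) :
  (forall i, ccontinuous (F i)) -> ccontinuous (fun k => \prod_(i <- r | P i) F i k).
Proof.
move=> Fc; elim: r => [|i r IHr].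
  by under eq_fun do rewrite big_nil; exact: (@ccontinuous_cst N).
under eq_fun do rewrite big_cons; case: (P i) => //; exact: ccontinuousM (Fc i) IHr.
Qed.

Lemma sqnormC_gt0 (z : R[i]) : (0 < sqnormC z) = (z != 0).
Proof.
case: z => a b; rewrite lt_neqAle sqnormC_ge0 andbT eq_sym.
rewrite /sqnormC/= paddr_eq0 ?sqr_ge0// !sqrf_eq0.
by rewrite eq_complex.
Qed.

(** The inverse of [z] is its conjugate divided by [sqnormC z], and [sqnormC (f k)] vanishes nowhere
    on the cube. *)
Lemma ccontinuousV N (f : 'rV[R]_N -> R[i]) : (forall k, cube R N k -> f k != 0) ->
  ccontinuous f -> ccontinuous (fun k => (f k)^-1).
Proof.
move=> f0 [/subspace_continuousP rf /subspace_continuousP jf].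
have nf k : cube R N k ->
    ((sqnormC (f k'))^-1 @[k' --> within (cube R N) (nbhs k)] --> (sqnormC (f k))^-1).
  move=> ck; apply: cvgV; first by rewrite gt_eqF// sqnormC_gt0 f0.
  by apply: cvgD; rewrite expr2; apply: cvgM; [exact: rf|exact: rf|exact: jf|exact: jf].
have ReV (z : R[i]) : complex.Re z^-1 = complex.Re z * (sqnormC z)^-1 by case: z.
have ImV (z : R[i]) : complex.Im z^-1 = - (complex.Im z * (sqnormC z)^-1) by case: z.
split; apply/subspace_continuousP => k ck.
  under eq_fun do rewrite ReV.
  by apply: cvgM; [exact: rf|exact: nf].
under eq_fun do rewrite ImV.
by apply: cvgN; apply: cvgM; [exact: jf|exact: nf].
Qed.

Definition cavg N j (f : 'rV[R]_N -> R[i]) (k : 'rV[R]_N) : R[i] :=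
  cube_integral (fun x : 'rV[R]_j => f (splice x k)).

Lemma ccontinuous_cavg N j (f : 'rV[R]_N -> R[i]) :
  ccontinuous f -> ccontinuous (cavg j f).
Proof. by move=> [rf jf]; split; [exact: (cube_continuous_avgr (j := j) rf)|
  exact: (cube_continuous_avgr (j := j) jf)]. Qed.

Lemma ccontinuous_bounded N (f : 'rV[R]_N -> R[i]) : ccontinuous f ->
  exists2 C : R, 0 <= C & forall k, cube R N k -> sqnormC (f k) <= C.
Proof.
move=> [rf jf]; have [A A0 fA] := cube_continuous_bounded rf.
have [B B0 fB] := cube_continuous_bounded jf.
exists (A ^+ 2 + B ^+ 2) => [|k ck]; first by rewrite addr_ge0 ?sqr_ge0.
rewrite /sqnormC -(real_normK (num_real (complex.Re _))) -(real_normK (num_real (complex.Im _))).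
by rewrite lerD// ler_sqr ?nnegrE ?normr_ge0// ?fA// fB.
Qed.

Definition cL2 N (f : 'rV[R]_N -> R[i]) : Prop :=
  L2r (fun k => complex.Re (f k)) /\ L2r (fun k => complex.Im (f k)).

Lemma cL2D N (f g : 'rV[R]_N -> R[i]) : cL2 f -> cL2 g -> cL2 (fun k => f k + g k).
Proof.
move=> [rf jf] [rg jg]; split; under eq_fun do rewrite raddfD; exact: L2rD.
Qed.

Lemma L2rN N (f : 'rV[R]_N -> R) : L2r f -> L2r (fun k => - f k).
Proof.
move=> [mf f2]; split; first exact: measurable_funN.
by under eq_integral do rewrite sqrrN.
Qed.

Lemma cL2_cst N (c : R[i]) : @cL2 N (fun=> c).
Proof. by split; exact: L2r_cst. Qed.

Lemma cL2M N (h f : 'rV[R]_N -> R[i]) :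
  ccontinuous h -> cL2 f -> cL2 (fun k => h k * f k).
Proof.
move=> [rh jh] [rf jf]; split.
  under eq_fun do rewrite complex_ReM.
  by apply: L2rD; [exact: L2r_continuousM|apply: L2rN; exact: L2r_continuousM].
under eq_fun do rewrite complex_ImM.
by apply: L2rD; exact: L2r_continuousM.
Qed.

Lemma cL2_sum N (I : Type) (r : seq I) (P : pred I) (F : I -> 'rV[R]_N -> R[i]) :
  (forall i, cL2 (F i)) -> cL2 (fun k => \sum_(i <- r | P i) F i k).
Proof.
move=> Fc; elim: r => [|i r IHr].
  by under eq_fun do rewrite big_nil; exact: (@cL2_cst N).
under eq_fun do rewrite big_cons; case: (P i) => //; exact: cL2D (Fc i) IHr.
Qed.

Lemma ccontinuous_cL2 N (f : 'rV[R]_N -> R[i]) : ccontinuous f -> cL2 f.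
Proof.
move=> fc; have := cL2M fc (cL2_cst N 1).
by under eq_fun do rewrite mulr1.
Qed.

Lemma cL2_cavg N j (f : 'rV[R]_N -> R[i]) : (j <= N)%N -> cL2 f -> cL2 (cavg j f).
Proof.
by move=> jN [rf jf]; split; [exact: (avgr_square_integrable jN rf).1|
  exact: (avgr_square_integrable jN jf).1].
Qed.

Lemma cube_integralD j (f g : 'rV[R]_j -> R[i]) : cL2 f -> cL2 g ->
  cube_integral (fun x => f x + g x) = cube_integral f + cube_integral g.
Proof.
move=> [rf jf] [rg jg]; have mcj := measurable_cube R j.
rewrite /cube_integral; under eq_Rintegral do rewrite raddfD.
under [X in _ +i* X]eq_Rintegral do rewrite raddfD.
by rewrite !RintegralD//; exact: L2r_integrable.
Qed.

Lemma cube_integral_cst j (c : R[i]) : cube_integral (fun _ : 'rV[R]_j => c) = c.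
Proof. by rewrite /cube_integral !Rintegral_cube_cst; case: c. Qed.

Lemma cube_integral_sum j (I : Type) (r : seq I) (P : pred I) (F : I -> 'rV[R]_j -> R[i]) :
  (forall i, cL2 (F i)) -> cube_integral (fun x => \sum_(i <- r | P i) F i x) =
    \sum_(i <- r | P i) cube_integral (F i).
Proof.
move=> F2; elim: r => [|i r IHr].
  by under eq_fun do rewrite big_nil; rewrite big_nil cube_integral_cst.
under eq_fun do rewrite big_cons; rewrite big_cons -IHr; case: (P i) => //.
by rewrite cube_integralD//; exact: cL2_sum.
Qed.

Lemma cube_integralMr j (f : 'rV[R]_j -> R[i]) (c : R[i]) : cL2 f ->
  cube_integral (fun x => f x * c) = cube_integral f * c.
Proof.
move=> [rf jf]; have mcj := measurable_cube R j.
have rI := L2r_integrable rf; have jI := L2r_integrable jf.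
have ZrI (r : R) g : (mu j).-integrable (cube R j) (EFin \o g) ->
    (mu j).-integrable (cube R j) (EFin \o (fun x => g x * r)).
  move=> gI; have := integrableZr mcj r gI.
  by apply: eq_integrable => // x _ /=.
apply/eqP; rewrite eq_complex complex_ReM complex_ImM /=; apply/andP; split.
  under eq_Rintegral do rewrite complex_ReM.
  by rewrite RintegralB ?RintegralZr//; exact: ZrI.
under eq_Rintegral do rewrite complex_ImM.
by rewrite RintegralD ?RintegralZr//; exact: ZrI.
Qed.

Lemma eq_cube_integral j (f g : 'rV[R]_j -> R[i]) :
  (forall x, cube R j x -> f x = g x) -> cube_integral f = cube_integral g.
Proof.
by move=> fg; congr (_ +i* _); apply: eq_Rintegral => x /set_mem /fg ->.
Qed.

End complex_on_cube.

(** * Matrix-valued functions *)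

Section matrices_on_cube.
Variable R : realType.
Local Notation mu N := (lebesgue_rV R N).

Definition mcontinuous N m n (A : 'rV[R]_N -> 'M[R[i]]_(m, n)) : Prop :=
  forall a b, ccontinuous (fun k => A k a b).

Lemma mcontinuousP N m n (A : 'rV[R]_N -> 'M[R[i]]_(m, n)) :
  {within cube R N, continuous A} <-> mcontinuous A.
Proof. exact: cube_continuous_mxP. Qed.

Lemma mcontinuous_cst N m n (C : 'M[R[i]]_(m, n)) : @mcontinuous N m n (fun=> C).
Proof. by move=> a b; exact: ccontinuous_cst. Qed.

Lemma mcontinuousD N m n (A B : 'rV[R]_N -> 'M[R[i]]_(m, n)) :
  mcontinuous A -> mcontinuous B -> mcontinuous (fun k => A k + B k).
Proof.
by move=> Ac Bc a b; under eq_fun do rewrite mxE; exact: ccontinuousD (Ac a b) (Bc a b).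
Qed.

Lemma mcontinuousM N m n p (A : 'rV[R]_N -> 'M[R[i]]_(m, n)) (B : 'rV[R]_N -> 'M[R[i]]_(n, p)) :
  mcontinuous A -> mcontinuous B -> mcontinuous (fun k => A k *m B k).
Proof.
move=> Ac Bc a b; under eq_fun do rewrite mxE.
by apply: (@ccontinuous_sum R N) => i; exact: ccontinuousM (Ac a i) (Bc i b).
Qed.

Lemma mcontinuousN N m n (A : 'rV[R]_N -> 'M[R[i]]_(m, n)) :
  mcontinuous A -> mcontinuous (fun k => - A k).
Proof.
move=> Ac a b; under eq_fun do rewrite mxE -mulN1r.
exact: ccontinuousM (@ccontinuous_cst R N _) (Ac a b).
Qed.

Lemma ccontinuous_det N n (A : 'rV[R]_N -> 'M[R[i]]_n) :
  mcontinuous A -> ccontinuous (fun k => \det (A k)).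
Proof.
move=> Ac; apply: (@ccontinuous_sum R N) => s.
apply: ccontinuousM; first exact: ccontinuous_cst.
by apply: (@ccontinuous_prod R N) => i; exact: Ac.
Qed.

(** Cramer's rule: wherever the determinant is nonzero, the entries of [invmx] are cofactors divided
    by it. *)
Lemma mcontinuous_invmx N n (A : 'rV[R]_N -> 'M[R[i]]_n) :
  mcontinuous A -> (forall k, cube R N k -> \det (A k) != 0) ->
  mcontinuous (fun k => invmx (A k)).
Proof.
move=> Ac A0 a b.
apply: (@eq_ccontinuous R N (fun k => (\det (A k))^-1 *
    ((-1) ^+ (b + a) * \det (row' b (col' a (A k)))))).
  by move=> k ck; rewrite /invmx unitmxE unitfE A0// !mxE.
apply: ccontinuousM; first by apply: ccontinuousV => //; exact: ccontinuous_det.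
apply: ccontinuousM; first exact: ccontinuous_cst.
by apply: ccontinuous_det => i l; under eq_fun do rewrite !mxE; exact: Ac.
Qed.

Lemma mcontinuous_row_mx N m n p (A : 'rV[R]_N -> 'M[R[i]]_(m, n))
    (B : 'rV[R]_N -> 'M[R[i]]_(m, p)) :
  mcontinuous A -> mcontinuous B -> mcontinuous (fun k => row_mx (A k) (B k)).
Proof.
move=> Ac Bc a b; case: (split_ordP b) => b' ->.
  by under eq_fun do rewrite row_mxEl; exact: Ac.
by under eq_fun do rewrite row_mxEr; exact: Bc.
Qed.

Lemma mcontinuous_col_mx N m n p (A : 'rV[R]_N -> 'M[R[i]]_(m, n))
    (B : 'rV[R]_N -> 'M[R[i]]_(p, n)) :
  mcontinuous A -> mcontinuous B -> mcontinuous (fun k => col_mx (A k) (B k)).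
Proof.
move=> Ac Bc a b; case: (split_ordP a) => a' ->.
  by under eq_fun do rewrite col_mxEu; exact: Ac.
by under eq_fun do rewrite col_mxEd; exact: Bc.
Qed.

Lemma mcontinuous_partial_avg N j m n (A : 'rV[R]_N -> 'M[R[i]]_(m, n)) :
  mcontinuous A -> mcontinuous (partial_avg j A).
Proof.
move=> Ac a b; under eq_fun do rewrite mxE.
exact: (ccontinuous_cavg j (Ac a b)).
Qed.

Lemma partial_avg_splice N j m n (F : 'rV[R]_N -> 'M[R[i]]_(m, n)) (x : 'rV[R]_j) k :
  partial_avg j F (splice x k) = partial_avg j F k.
Proof.
apply/matrixP => a b; rewrite !mxE; apply: eq_cube_integral => y _.
by rewrite spliceK.
Qed.

(** Entrywise and for any matrix shape, so that it also covers products and functions with values in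
    the auxiliary space; for columns it agrees with [square_integrable] by [square_integrableE]. *)
Definition mL2 N m n (F : 'rV[R]_N -> 'M[R[i]]_(m, n)) : Prop :=
  forall a b, cL2 (fun k => F k a b).

Lemma mcontinuous_mL2 N m n (A : 'rV[R]_N -> 'M[R[i]]_(m, n)) :
  mcontinuous A -> mL2 A.
Proof. by move=> Ac a b; exact: ccontinuous_cL2. Qed.

Lemma mL2D N m n (F G : 'rV[R]_N -> 'M[R[i]]_(m, n)) :
  mL2 F -> mL2 G -> mL2 (fun k => F k + G k).
Proof.
by move=> F2 G2 a b; under eq_fun do rewrite mxE; exact: cL2D (F2 a b) (G2 a b).
Qed.

Lemma mcontinuous_slice_mL2 N j m n (A : 'rV[R]_N -> 'M[R[i]]_(m, n)) k :
  mcontinuous A -> cube R N k -> mL2 (fun x : 'rV[R]_j => A (splice x k)).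
Proof.
move=> Ac ck; apply: mcontinuous_mL2 => a b; have [rc ic] := Ac a b.
by split; [exact: (cube_continuous_splice (j := j) rc)|
  exact: (cube_continuous_splice (j := j) ic)].
Qed.

Lemma mL2M N m n p (A : 'rV[R]_N -> 'M[R[i]]_(m, n)) (F : 'rV[R]_N -> 'M[R[i]]_(n, p)) :
  mcontinuous A -> mL2 F -> mL2 (fun k => A k *m F k).
Proof.
move=> Ac F2 a b; under eq_fun do rewrite mxE.
by apply: (@cL2_sum R N) => i; exact: cL2M (Ac a i) (F2 i b).
Qed.

Lemma mL2Z N m n c (F : 'rV[R]_N -> 'M[R[i]]_(m, n)) :
  mL2 F -> mL2 (fun k => c *: F k).
Proof.
move=> F2 a b; under eq_fun do rewrite mxE.
exact: cL2M (@ccontinuous_cst R N c) (F2 a b).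
Qed.

Lemma mL2_partial_avg N j m n (F : 'rV[R]_N -> 'M[R[i]]_(m, n)) :
  (j <= N)%N -> mL2 F -> mL2 (partial_avg j F).
Proof.
move=> jN F2 a b; under eq_fun do rewrite mxE.
exact: (cL2_cavg jN (F2 a b)).
Qed.

Lemma ae_slice_mL2 N j m n (F : 'rV[R]_N -> 'M[R[i]]_(m, n)) : (j <= N)%N -> mL2 F ->
  {ae mu N, forall k, cube R N k -> mL2 (fun x : 'rV[R]_j => F (splice x k))}.
Proof.
move=> jN F2.
have : {ae mu N, forall k, forall a b, cube R N k ->
    cL2 (fun x : 'rV[R]_j => F (splice x k) a b)}.
  apply: filter_forall => a; apply: filter_forall => b; have [rF jF] := F2 a b.
  have := ae_slice_square_integrable jN rF.
  apply: filterS2 (ae_slice_square_integrable jN jF) => k jk rk ck.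
  by split; [exact: rk|exact: jk].
by apply: filterS => k H ck a b; exact: H.
Qed.

Lemma ae_eq_partial_avg N j m n (F G : 'rV[R]_N -> 'M[R[i]]_(m, n)) : (j <= N)%N ->
  mL2 F -> mL2 G -> {ae mu N, forall k, cube R N k -> F k = G k} ->
  {ae mu N, forall k, cube R N k -> partial_avg j F k = partial_avg j G k}.
Proof.
move=> jN F2 G2 FG.
have : {ae mu N, forall k, forall a b, cube R N k ->
    cavg j (fun q => F q a b) k = cavg j (fun q => G q a b) k}.
  apply: filter_forall => a; apply: filter_forall => b.
  have [[rF _] [jF _]] := F2 a b; have [[rG _] [jG _]] := G2 a b.
  have re : {ae mu N, forall k, cube R N k -> complex.Re (F k a b) = complex.Re (G k a b)}.
    by apply: filterS FG => k FGk ck; rewrite FGk.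
  have im : {ae mu N, forall k, cube R N k -> complex.Im (F k a b) = complex.Im (G k a b)}.
    by apply: filterS FG => k FGk ck; rewrite FGk.
  have := ae_eq_avgr jN rF rG re.
  apply: filterS2 (ae_eq_avgr jN jF jG im) => k ik rk ck.
  by congr (_ +i* _); [exact: rk|exact: ik].
by apply: filterS => k H ck; apply/matrixP => a b; rewrite !mxE; exact: H.
Qed.

Lemma partial_avgD N j m n (F G : 'rV[R]_N -> 'M[R[i]]_(m, n)) k :
  mL2 (fun x : 'rV[R]_j => F (splice x k)) ->
  mL2 (fun x : 'rV[R]_j => G (splice x k)) ->
  partial_avg j (fun q => F q + G q) k = partial_avg j F k + partial_avg j G k.
Proof.
move=> F2 G2; apply/matrixP => a b; rewrite !mxE.
by under eq_fun do rewrite mxE; exact: cube_integralD (F2 a b) (G2 a b).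
Qed.

(** The identity behind all the algebra. The factor [C] will be an inner average (composition), the
    inverse of D (inverse formula) and an approximate kernel vector (converse). *)
Lemma partial_avgMr N j m n p (F : 'rV[R]_N -> 'M[R[i]]_(m, n))
    (C : 'rV[R]_N -> 'M[R[i]]_(n, p)) k :
  mL2 (fun x : 'rV[R]_j => F (splice x k)) ->
  (forall x : 'rV[R]_j, cube R j x -> C (splice x k) = C k) ->
  partial_avg j (fun q => F q *m C q) k = partial_avg j F k *m C k.
Proof.
move=> F2 Ck; apply/matrixP => a c; rewrite !mxE.
transitivity (cube_integral (fun x : 'rV[R]_j => \sum_b F (splice x k) a b * C k b c)).
  by apply: eq_cube_integral => x cx; rewrite mxE Ck.
rewrite cube_integral_sum; last first.
  move=> b; under eq_fun do rewrite mulrC.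
  exact: cL2M (@ccontinuous_cst R j _) (F2 a b).
by apply: eq_bigr => b _; rewrite mxE cube_integralMr//; exact: F2.
Qed.

Lemma partial_avgZ N j m n c (F : 'rV[R]_N -> 'M[R[i]]_(m, n)) k :
  mL2 (fun x : 'rV[R]_j => F (splice x k)) ->
  partial_avg j (fun q => c *: F q) k = c *: partial_avg j F k.
Proof.
move=> F2; apply/matrixP => a b; rewrite !mxE.
transitivity (cube_integral (fun x : 'rV[R]_j => F (splice x k) a b * c)).
  by apply: eq_cube_integral => x _; rewrite mxE mulrC.
by rewrite cube_integralMr; [exact: mulrC|exact: F2].
Qed.

(** The squared L2 norm on representatives, kept extended-real so that estimates need no prior
    finiteness. *)
Definition sqL2 N m (u : 'rV[R]_N -> 'cV[R[i]]_m) : \bar R :=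
  (\int[mu N]_(k in cube R N) (sqnorm_cV (u k))%:E)%E.

Lemma measurable_fun_sqL2 N m (u : 'rV[R]_N -> 'cV[R[i]]_m) : mL2 u ->
  measurable_fun (cube R N) (fun k => (sqnorm_cV (u k))%:E).
Proof.
move=> u2; apply/measurable_EFinP; apply: measurable_sqnorm => i.
by split; [exact: (u2 i ord0).1.1|exact: (u2 i ord0).2.1].
Qed.

Lemma sqL2_ge0 N m (u : 'rV[R]_N -> 'cV[R[i]]_m) : (0 <= sqL2 u)%E.
Proof. by apply: integral_ge0 => k _; rewrite lee_fin sqnorm_cV_ge0. Qed.

Lemma sqL2E N m (u : 'rV[R]_N -> 'cV[R[i]]_m) : mL2 u ->
  sqL2 u = (\sum_i (\int[mu N]_(k in cube R N) (complex.Re (u k i ord0) ^+ 2)%:E +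
                    \int[mu N]_(k in cube R N) (complex.Im (u k i ord0) ^+ 2)%:E))%E.
Proof.
move=> u2; have mcN := measurable_cube R N.
have mr i : measurable_fun (cube R N) (fun k => (complex.Re (u k i ord0) ^+ 2)%:E).
  by apply/measurable_EFinP; apply: measurable_funX; exact: (u2 i ord0).1.1.
have mi i : measurable_fun (cube R N) (fun k => (complex.Im (u k i ord0) ^+ 2)%:E).
  by apply/measurable_EFinP; apply: measurable_funX; exact: (u2 i ord0).2.1.
rewrite /sqL2; under eq_integral do rewrite /sqnorm_cV -sumEFin.
rewrite ge0_integral_sum//; last 2 first.
- by move=> i; under eq_fun do rewrite /sqnormC EFinD; exact: emeasurable_funD.
- by move=> i k _; rewrite lee_fin sqnormC_ge0.
apply: eq_bigr => i _; rewrite /sqnormC.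
under eq_integral do rewrite EFinD.
by rewrite ge0_integralD// => k _; rewrite lee_fin sqr_ge0.
Qed.

Lemma square_integrableE N m (u : 'rV[R]_N -> 'cV[R[i]]_m) :
  square_integrable u <-> mL2 u.
Proof.
have mcN := measurable_cube R N.
split => [[mu2 iu] i b|u2].
  have [mr mi] := mu2 i; rewrite (ord1 b).
  have le_part (h : 'rV[R]_N -> R) : measurable_fun (cube R N) h ->
      (forall k, h k ^+ 2 <= sqnormC (u k i ord0)) -> L2r h.
    move=> mh hu; split => //; apply: le_lt_trans iu; apply: ge0_le_integral => //.
    - by move=> k _; rewrite lee_fin sqr_ge0.
    - by apply/measurable_EFinP; exact: measurable_funX.
    - by apply/measurable_EFinP; exact: measurable_sqnorm.
    - move=> k _; rewrite lee_fin; apply: le_trans (hu k) _.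
      rewrite /sqnorm_cV (bigD1 i)//= lerDl sumr_ge0// => l _; exact: sqnormC_ge0.
  by split; apply: le_part => // k; rewrite /sqnormC ?lerDl ?lerDr sqr_ge0.
split; first by move=> i; split; [exact: (u2 i ord0).1.1|exact: (u2 i ord0).2.1].
change (sqL2 u < +oo)%E; rewrite sqL2E//; apply: lte_sum_pinfty => i _.
by apply: lte_add_pinfty; [exact: (u2 i ord0).1.2|exact: (u2 i ord0).2.2].
Qed.

Lemma sqL2_lty N m (u : 'rV[R]_N -> 'cV[R[i]]_m) : mL2 u -> (sqL2 u < +oo)%E.
Proof. by move=> /square_integrableE[]. Qed.

Lemma sqL2_partial_avg N j m (u : 'rV[R]_N -> 'cV[R[i]]_m) : (j <= N)%N -> mL2 u ->
  (sqL2 (partial_avg j u) <= sqL2 u)%E.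
Proof.
move=> jN u2; rewrite !sqL2E//; last exact: mL2_partial_avg.
apply: lee_sum => i _; apply: leeD.
  have [_] := avgr_square_integrable jN (u2 i ord0).1.
  by apply: le_trans; under eq_integral do rewrite mxE.
have [_] := avgr_square_integrable jN (u2 i ord0).2.
by apply: le_trans; under eq_integral do rewrite mxE.
Qed.

Lemma sqL2_le N m p (u : 'rV[R]_N -> 'cV[R[i]]_m) (v : 'rV[R]_N -> 'cV[R[i]]_p) (C : R) :
  0 <= C -> mL2 u -> mL2 v ->
  (forall k, cube R N k -> sqnorm_cV (u k) <= C * sqnorm_cV (v k)) ->
  (sqL2 u <= C%:E * sqL2 v)%E.
Proof.
move=> C0 u2 v2 uv; have mcN := measurable_cube R N.
rewrite /sqL2 -ge0_integralZl//; last 2 first.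
- exact: measurable_fun_sqL2.
- by move=> k _; rewrite lee_fin sqnorm_cV_ge0.
apply: ge0_le_integral => //.
- by move=> k _; rewrite lee_fin sqnorm_cV_ge0.
- exact: measurable_fun_sqL2.
- by apply: measurable_funeM; exact: measurable_fun_sqL2.
Qed.

Lemma sqnormCD (x y : R[i]) : sqnormC (x + y) <= 2 * sqnormC x + 2 * sqnormC y.
Proof.
case: x y => [a b] [c d]; rewrite /sqnormC/=.
by have := sqr_ge0 (a - c); have := sqr_ge0 (b - d); nra.
Qed.

Lemma sqnormCM (x y : R[i]) : sqnormC (x * y) = sqnormC x * sqnormC y.
Proof. by case: x y => [a b] [c d]; rewrite /sqnormC/=; ring. Qed.

(** Each use of [sqnormCD] costs a factor 2, whence [2 ^ n]. *)
Lemma sqnormC_sum n (F : 'I_n -> R[i]) :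
  sqnormC (\sum_i F i) <= 2 ^+ n * \sum_i sqnormC (F i).
Proof.
elim: n F => [|n IHn] F; first by rewrite !big_ord0 /sqnormC/= expr0n addr0 mulr0.
rewrite !big_ord_recl; apply: le_trans (sqnormCD _ _) _.
rewrite [leRHS]mulrDr lerD//.
  rewrite ler_wpM2r ?sqnormC_ge0//.
  by rewrite exprS ler_peMr// exprn_ege1// ler1n.
by rewrite exprS -mulrA ler_wpM2l.
Qed.

Lemma sqnorm_cVD m (x y : 'cV[R[i]]_m) :
  sqnorm_cV (x + y) <= 2 * sqnorm_cV x + 2 * sqnorm_cV y.
Proof.
rewrite /sqnorm_cV !mulr_sumr -big_split; apply: ler_sum => i _.
by rewrite mxE; exact: sqnormCD.
Qed.

(** Compactness bounds all entries by a common [K]; each of the [m] rows then contributes at most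
    [2 ^ n * K]. *)
Lemma sqnorm_mulmx_le N m n (A : 'rV[R]_N -> 'M[R[i]]_(m, n)) : mcontinuous A ->
  exists2 C : R, 0 <= C & forall k (v : 'cV_n), cube R N k ->
    sqnorm_cV (A k *m v) <= C * sqnorm_cV v.
Proof.
move=> Ac.
have [K K0 AK] : exists2 K : R, 0 <= K &
    forall k a b, cube R N k -> sqnormC (A k a b) <= K.
  have /choice[K' HK] : forall ab : 'I_m * 'I_n, exists C : R, 0 <= C /\
      forall k, cube R N k -> sqnormC (A k ab.1 ab.2) <= C.
    by move=> ab; have [C ? ?] := ccontinuous_bounded (Ac ab.1 ab.2); exists C.
  exists (\sum_ab K' ab); first by apply: sumr_ge0 => ab _; exact: (HK ab).1.
  move=> k a b ck; apply: le_trans ((HK (a, b)).2 k ck) _.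
  by rewrite (bigD1 (a, b))//= lerDl sumr_ge0// => ab _; exact: (HK ab).1.
exists (\sum_(a < m) 2 ^+ n * K).
  by apply: sumr_ge0 => a _; rewrite mulr_ge0// exprn_ge0.
move=> k v ck; rewrite {1}/sqnorm_cV mulr_suml; apply: ler_sum => a _.
rewrite mxE; apply: le_trans (sqnormC_sum _) _.
rewrite -mulrA ler_wpM2l ?exprn_ge0// mulr_sumr; apply: ler_sum => b _.
by rewrite sqnormCM ler_wpM2r ?sqnormC_ge0// AK.
Qed.

Lemma sqL2_mulmx N m n (A : 'rV[R]_N -> 'M[R[i]]_(m, n)) : mcontinuous A ->
  exists2 C : R, 0 <= C & forall u : 'rV[R]_N -> 'cV[R[i]]_n, mL2 u ->
    (sqL2 (fun k => A k *m u k) <= C%:E * sqL2 u)%E.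
Proof.
move=> Ac; have [C C0 AC] := sqnorm_mulmx_le Ac.
exists C => // u u2; apply: sqL2_le => //; first exact: mL2M.
by move=> k ck; exact: AC.
Qed.

Lemma sqL2D N m (u v : 'rV[R]_N -> 'cV[R[i]]_m) : mL2 u -> mL2 v ->
  (sqL2 (fun k => (u k + v k)%R) <= 2%:E * sqL2 u + 2%:E * sqL2 v)%E.
Proof.
move=> u2 v2; have mcN := measurable_cube R N.
have mu' := measurable_fun_sqL2 u2; have mv := measurable_fun_sqL2 v2.
rewrite /sqL2 -!ge0_integralZl//; last 2 first.
- by move=> k _; rewrite lee_fin sqnorm_cV_ge0.
- by move=> k _; rewrite lee_fin sqnorm_cV_ge0.
rewrite -ge0_integralD//; last 4 first.
- by move=> k _; rewrite -EFinM lee_fin mulr_ge0// sqnorm_cV_ge0.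
- exact: measurable_funeM.
- by move=> k _; rewrite -EFinM lee_fin mulr_ge0// sqnorm_cV_ge0.
- exact: measurable_funeM.
apply: ge0_le_integral => //.
- by move=> k _; rewrite lee_fin sqnorm_cV_ge0.
- by apply: measurable_fun_sqL2; exact: mL2D.
- by apply: emeasurable_funD; exact: measurable_funeM.
- by move=> k ck; rewrite -!EFinM -EFinD lee_fin sqnorm_cVD.
Qed.

End matrices_on_cube.

(** * Operators on L2 *)

Section L2_classes.
Local Open Scope quotient_scope.
Variables (R : realType) (N M : nat).
Local Notation mu := (lebesgue_rV R N).
Implicit Types (f g : 'rV[R]_N -> 'cV[R[i]]_M) (u v : L2 R N M).

Lemma L2_to_fun_mL2 u : mL2 (L2_to_fun u).
Proof.
apply/square_integrableE; rewrite /L2_to_fun.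
by case: (repr u) => f /= /set_mem.
Qed.

Lemma val_insubd_L2 f : mL2 f -> L2fun_val (insubd (0 : L2fun R N M) f) = f.
Proof.
by move=> f2; apply: (@insubdK _ _ (L2fun R N M)); rewrite inE; exact/square_integrableE.
Qed.

(** The representative picked by [repr] is unknown; only its difference from [f] is known to lie in
    [L2null]. *)
Lemma L2classK f : mL2 f ->
  {ae mu, forall k, cube R N k -> L2_to_fun (L2class f) k = f k}.
Proof.
move=> f2; have : L2class f == \pi_(L2 R N M) (insubd 0 f) by [].
rewrite -{1}[L2class f]reprK -Quotient.idealrBE inE /=.
apply: filterS => k fk ck.
have : L2fun_val (repr (L2class f)) k - L2fun_val (insubd (0 : L2fun R N M) f) k = 0.
  exact: fk.
by move/eqP; rewrite subr_eq0 val_insubd_L2// => /eqP.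
Qed.

Lemma L2class_eq f g : mL2 f -> mL2 g ->
  {ae mu, forall k, cube R N k -> f k = g k} -> L2class f = L2class g.
Proof.
move=> f2 g2 fg; apply/eqP; rewrite -Quotient.idealrBE inE /=.
apply: filterS fg => k fgk ck.
change (L2fun_val (insubd (0 : L2fun R N M) f) k - L2fun_val (insubd (0 : L2fun R N M) g) k = 0).
by rewrite !val_insubd_L2// fgk// subrr.
Qed.

Lemma L2_to_funK u : L2class (L2_to_fun u) = u.
Proof.
rewrite /L2class /L2_to_fun -[RHS]reprK; congr (\pi_(L2 R N M) _).
by apply: val_inj; rewrite /= val_insubd_L2//; exact: L2_to_fun_mL2.
Qed.

Lemma L2classD f g : mL2 f -> mL2 g ->
  L2class (fun k => f k + g k) = L2class f + L2class g.
Proof.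
move=> f2 g2; rewrite /L2class -pi_L2D; congr (\pi_(L2 R N M) _).
apply: val_inj; rewrite /= val_insubd_L2; last exact: mL2D.
by apply/funext => k; rewrite -{1}(val_insubd_L2 f2) -{1}(val_insubd_L2 g2).
Qed.

Lemma L2classZ a f : mL2 f -> L2class (fun k => a *: f k) = a *: L2class f.
Proof.
move=> f2; rewrite /L2class -[RHS]pi_L2Z; congr (\pi_(L2 R N M) _).
apply: val_inj; rewrite /= val_insubd_L2; last exact: mL2Z.
by apply/funext => k; rewrite -{1}(val_insubd_L2 f2).
Qed.

Lemma ae_eq_sqL2 f g : mL2 f -> mL2 g ->
  {ae mu, forall k, cube R N k -> f k = g k} -> sqL2 f = sqL2 g.
Proof.
move=> f2 g2 fg; apply: ae_eq_integral.
- exact: measurable_cube.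
- exact: measurable_fun_sqL2.
- exact: measurable_fun_sqL2.
- by apply: filterS fg => k fgk ck; rewrite fgk.
Qed.

Lemma L2normE u : L2norm u = Num.sqrt (fine (sqL2 (L2_to_fun u))).
Proof. by []. Qed.

Lemma L2norm_class f : mL2 f -> L2norm (L2class f) = Num.sqrt (fine (sqL2 f)).
Proof.
move=> f2; rewrite L2normE (@ae_eq_sqL2 _ f)//; first exact: L2_to_fun_mL2.
exact: L2classK.
Qed.

(** Linearity of [Phi] is asked only almost everywhere, as averages provide no more, and
    compatibility with almost everywhere equality is needed because the representative of
    [a *: u + v] is not the combination of those of [u] and [v]. *)
Lemma bounded_operator_class (Phi : ('rV[R]_N -> 'cV[R[i]]_M) -> 'rV[R]_N -> 'cV[R[i]]_M)
    (C : R) :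
  (forall f, mL2 f -> mL2 (Phi f)) ->
  (forall a f g, mL2 f -> mL2 g -> {ae mu, forall k, cube R N k ->
     Phi (fun k => a *: f k + g k) k = a *: Phi f k + Phi g k}) ->
  (forall f g, mL2 f -> mL2 g -> {ae mu, forall k, cube R N k -> f k = g k} ->
     {ae mu, forall k, cube R N k -> Phi f k = Phi g k}) ->
  (forall f, mL2 f -> (sqL2 (Phi f) <= C%:E * sqL2 f)%E) -> 0 <= C ->
  bounded_operator (fun u : L2 R N M => L2class (Phi (L2_to_fun u))).
Proof.
move=> Phi2 Philin Phiae PhiC C0; split => [a u v|].
  have [u2 v2] := (L2_to_fun_mL2 u, L2_to_fun_mL2 v).
  have auv2 := mL2D (mL2Z a u2) v2.
  rewrite -L2classZ; last exact: Phi2.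
  rewrite -L2classD; [|by apply: mL2Z; exact: Phi2|exact: Phi2].
  apply: L2class_eq.
  - by apply: Phi2; exact: L2_to_fun_mL2.
  - by apply: mL2D; [apply: mL2Z|]; exact: Phi2.
  have uv : {ae mu, forall k, cube R N k ->
      L2_to_fun (a *: u + v) k = a *: L2_to_fun u k + L2_to_fun v k}.
    have -> : a *: u + v = L2class (fun k => a *: L2_to_fun u k + L2_to_fun v k).
      by rewrite L2classD ?L2classZ ?L2_to_funK//; exact: mL2Z.
    exact: L2classK.
  have := Phiae _ _ (L2_to_fun_mL2 _) auv2 uv.
  apply: filterS2 (Philin a _ _ u2 v2) => k h1 h2 ck.
  by rewrite h2// h1.
exists (Num.sqrt C) => u; have u2 := L2_to_fun_mL2 u.
rewrite L2norm_class ?L2normE; last exact: Phi2.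
rewrite -sqrtrM// ler_wsqrtr//.
have := PhiC _ u2; have := sqL2_lty u2; have := sqL2_lty (Phi2 _ u2).
case: (sqL2 (Phi _)) (sqL2_ge0 (Phi (L2_to_fun u))) => // x _.
by case: (sqL2 (L2_to_fun u)) (sqL2_ge0 (L2_to_fun u)).
Qed.

End L2_classes.

Section averaging_operators.
Variables (R : realType) (N : nat) (j : nat).
Hypothesis jN : (j <= N)%N.
Local Notation mu := (lebesgue_rV R N).

Definition avg_fun m p q (A : 'rV[R]_N -> 'M[R[i]]_(m, p)) (B : 'rV[R]_N -> 'M[R[i]]_(p, q))
    (f : 'rV[R]_N -> 'cV[R[i]]_q) : 'rV[R]_N -> 'cV[R[i]]_m :=
  fun k => A k *m partial_avg j (fun l => B l *m f l) k.

Section one_pair.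
Variables (m p q : nat).
Variables (A : 'rV[R]_N -> 'M[R[i]]_(m, p)) (B : 'rV[R]_N -> 'M[R[i]]_(p, q)).
Hypotheses (Ac : mcontinuous A) (Bc : mcontinuous B).
Implicit Types f g : 'rV[R]_N -> 'cV[R[i]]_q.

Lemma mL2_avg_fun f : mL2 f -> mL2 (avg_fun A B f).
Proof. by move=> f2; apply: mL2M => //; apply: mL2_partial_avg => //; exact: mL2M. Qed.

Lemma avg_fun_lin a f g : mL2 f -> mL2 g -> {ae mu, forall k, cube R N k ->
  avg_fun A B (fun k => a *: f k + g k) k = a *: avg_fun A B f k + avg_fun A B g k}.
Proof.
move=> f2 g2; have := ae_slice_mL2 jN (mL2M Bc f2).
apply: filterS2 (ae_slice_mL2 jN (mL2M Bc g2)) => k gk fk ck.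
rewrite /avg_fun scalemxAr -mulmxDr.
have -> : (fun l => B l *m (a *: f l + g l)) = fun l => a *: (B l *m f l) + B l *m g l.
  by apply/funext => l; rewrite mulmxDr -scalemxAr.
rewrite partial_avgD; last 2 first.
- by apply: mL2Z; exact: fk.
- exact: gk.
by rewrite partial_avgZ//; exact: fk.
Qed.

Lemma ae_eq_avg_fun f g : mL2 f -> mL2 g ->
  {ae mu, forall k, cube R N k -> f k = g k} ->
  {ae mu, forall k, cube R N k -> avg_fun A B f k = avg_fun A B g k}.
Proof.
move=> f2 g2 fg.
have : {ae mu, forall k, cube R N k -> B k *m f k = B k *m g k}.
  by apply: filterS fg => k fgk ck; rewrite fgk.
move=> /(ae_eq_partial_avg jN (mL2M Bc f2) (mL2M Bc g2)).
by apply: filterS => k H ck; rewrite /avg_fun H.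
Qed.

Lemma sqL2_avg_fun : exists2 C : R, 0 <= C & forall f, mL2 f ->
  (sqL2 (avg_fun A B f) <= C%:E * sqL2 f)%E.
Proof.
have [C C0 AC] := sqL2_mulmx Ac; have [D D0 BD] := sqL2_mulmx Bc.
exists (C * D) => [|f f2]; first exact: mulr_ge0.
have Bf2 := mL2M Bc f2.
apply: le_trans (AC _ (mL2_partial_avg jN Bf2)) _.
rewrite EFinM -muleA lee_wpmul2l// (le_trans (sqL2_partial_avg jN Bf2))//.
exact: BD.
Qed.

(* The inner average is constant along slices, so it factors out of the outer one. *)
Lemma avg_fun_comp r s n (A' : 'rV[R]_N -> 'M[R[i]]_(r, s)) (B' : 'rV[R]_N -> 'M[R[i]]_(s, n))
    (C : 'rV[R]_N -> 'M[R[i]]_(n, p)) f k :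
  mcontinuous B' -> mcontinuous C -> cube R N k ->
  avg_fun A' B' (avg_fun C B f) k =
  A' k *m partial_avg j (fun l => B' l *m C l) k *m partial_avg j (fun l => B l *m f l) k.
Proof.
move=> B'c Cc ck; rewrite -mulmxA -partial_avgMr.
- rewrite /avg_fun; have -> // : (fun l => B' l *m (C l *m partial_avg j (fun q => B q *m f q) l)) =
    fun l => B' l *m C l *m partial_avg j (fun q => B q *m f q) l.
  by apply/funext => l; rewrite mulmxA.
- exact: mcontinuous_slice_mL2 (mcontinuousM B'c Cc) ck.
- by move=> x cx; exact: partial_avg_splice.
Qed.

End one_pair.

End averaging_operators.

(** * The algebra of the operators I + A <B .> *)

Section identity_plus_averaging.
Variables (R : realType) (N M j : nat).
Hypothesis jN : (j <= N)%N.
Implicit Types (f g : 'rV[R]_N -> 'cV[R[i]]_M) (u v : L2 R N M).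

(** Lets the operator be computed on any representative, not only on the one chosen by [repr]. *)
Lemma id_avg_op_class p (A : 'rV[R]_N -> 'M[R[i]]_(M, p)) (B : 'rV[R]_N -> 'M[R[i]]_(p, M)) f :
  mcontinuous A -> mcontinuous B -> mL2 f ->
  (id \+ avg_op j A B) (L2class f) = L2class (fun k => f k + avg_fun j A B f k).
Proof.
move=> Ac Bc f2.
have opE : avg_op j A B (L2class f) = L2class (avg_fun j A B f).
  apply: L2class_eq.
  - by apply: (mL2_avg_fun jN Ac Bc); exact: L2_to_fun_mL2.
  - exact: (mL2_avg_fun jN Ac Bc f2).
  - exact: (ae_eq_avg_fun jN A Bc (L2_to_fun_mL2 _) f2 (L2classK f2)).
rewrite [RHS](L2classD f2 (mL2_avg_fun jN Ac Bc f2)).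
exact: (congr1 (fun w => L2class f + w) opE).
Qed.

Lemma id_avg_opE p (A : 'rV[R]_N -> 'M[R[i]]_(M, p)) (B : 'rV[R]_N -> 'M[R[i]]_(p, M)) u :
  mcontinuous A -> mcontinuous B ->
  (id \+ avg_op j A B) u = L2class (fun k => L2_to_fun u k + avg_fun j A B (L2_to_fun u) k).
Proof.
by move=> Ac Bc; rewrite -{1}[u]L2_to_funK id_avg_op_class//; exact: L2_to_fun_mL2.
Qed.

Lemma bounded_id_avg_op p (A : 'rV[R]_N -> 'M[R[i]]_(M, p)) (B : 'rV[R]_N -> 'M[R[i]]_(p, M)) :
  mcontinuous A -> mcontinuous B -> bounded_operator (id \+ avg_op j A B).
Proof.
move=> Ac Bc; have [C C0 ABC] := sqL2_avg_fun jN Ac Bc.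
have -> : id \+ avg_op j A B = fun u : L2 R N M =>
    L2class (fun k => L2_to_fun u k + avg_fun j A B (L2_to_fun u) k).
  by apply/funext => u; rewrite id_avg_opE.
apply: (@bounded_operator_class R N M (fun f k => f k + avg_fun j A B f k) (2 + 2 * C)).
- by move=> f f2; apply: mL2D => //; exact: mL2_avg_fun.
- move=> a f g f2 g2; apply: filterS (avg_fun_lin jN A Bc a f2 g2) => k fgk ck.
  by rewrite fgk// scalerDr addrACA.
- move=> f g f2 g2 fg; have := ae_eq_avg_fun jN A Bc f2 g2 fg.
  by apply: filterS2 fg => k fgk h ck; rewrite (fgk ck) (h ck).
- move=> f f2; apply: le_trans (sqL2D f2 (mL2_avg_fun jN Ac Bc f2)) _.
  have -> : ((2 + 2 * C)%R%:E * sqL2 f = 2%:E * sqL2 f + (2 * C)%R%:E * sqL2 f)%E.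
    by rewrite EFinD ge0_muleDl// lee_fin mulr_ge0.
  by rewrite leeD2l// EFinM -muleA lee_wpmul2l// ABC.
- by rewrite addr_ge0 ?mulr_ge0.
Qed.

(** The terms are grouped by the averages <B1 u> and <B2 u>, the cross term A1 <B1 A2> <B2 u>
    joining the latter. Distinct B give closure under composition; equal B let the coefficients
    cancel. *)
Lemma id_avg_op_comp p q (A1 : 'rV[R]_N -> 'M[R[i]]_(M, p)) (B1 : 'rV[R]_N -> 'M[R[i]]_(p, M))
    (A2 : 'rV[R]_N -> 'M[R[i]]_(M, q)) (B2 : 'rV[R]_N -> 'M[R[i]]_(q, M)) u :
  mcontinuous A1 -> mcontinuous B1 -> mcontinuous A2 -> mcontinuous B2 ->
  ((id \+ avg_op j A1 B1) \o (id \+ avg_op j A2 B2)) u =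
  L2class (fun k => L2_to_fun u k + avg_fun j A1 B1 (L2_to_fun u) k +
    avg_fun j (fun k => A2 k + A1 k *m partial_avg j (fun l => B1 l *m A2 l) k) B2
      (L2_to_fun u) k).
Proof.
move=> A1c B1c A2c B2c; have u2 := L2_to_fun_mL2 u.
have a2 := mL2_avg_fun jN A2c B2c u2.
have A'c : mcontinuous (fun k => A2 k + A1 k *m partial_avg j (fun l => B1 l *m A2 l) k).
  by apply: mcontinuousD => //; apply: mcontinuousM => //; apply: mcontinuous_partial_avg;
    exact: mcontinuousM.
transitivity ((id \+ avg_op j A1 B1) ((id \+ avg_op j A2 B2) u)) => //.
rewrite (id_avg_opE u A2c B2c) (id_avg_op_class A1c B1c (mL2D u2 a2)).
apply: L2class_eq.
- by apply: mL2D; [exact: mL2D|apply: (mL2_avg_fun jN A1c B1c); exact: mL2D].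
- by apply: mL2D; [apply: mL2D => //|]; exact: mL2_avg_fun.
(* Additivity is linearity with scalar 1. *)
have := avg_fun_lin jN A1 B1c 1 u2 a2.
have uE : (fun k => 1 *: L2_to_fun u k + avg_fun j A2 B2 (L2_to_fun u) k) =
    fun k => L2_to_fun u k + avg_fun j A2 B2 (L2_to_fun u) k.
  by apply/funext => k; rewrite scale1r.
rewrite uE; apply: filterS => k + ck => /(_ ck) ->.
rewrite scale1r avg_fun_comp// [X in _ = _ + X]/avg_fun mulmxDl -!addrA; congr (_ + _).
by rewrite addrCA.
Qed.

(** A block product of a row by a column; the cross term is absorbed into the second block of the
    row. *)
Lemma id_avg_op_compE p q (A1 : 'rV[R]_N -> 'M[R[i]]_(M, p)) (B1 : 'rV[R]_N -> 'M[R[i]]_(p, M))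
    (A2 : 'rV[R]_N -> 'M[R[i]]_(M, q)) (B2 : 'rV[R]_N -> 'M[R[i]]_(q, M)) :
  mcontinuous A1 -> mcontinuous B1 -> mcontinuous A2 -> mcontinuous B2 ->
  (id \+ avg_op j A1 B1) \o (id \+ avg_op j A2 B2) =
  id \+ avg_op j
    (fun k => row_mx (A1 k) (A2 k + A1 k *m partial_avg j (fun l => B1 l *m A2 l) k))
    (fun k => col_mx (B1 k) (B2 k)).
Proof.
move=> A1c B1c A2c B2c; apply/funext => u; rewrite id_avg_op_comp//.
have A'c : mcontinuous (fun k => A2 k + A1 k *m partial_avg j (fun l => B1 l *m A2 l) k).
  by apply: mcontinuousD => //; apply: mcontinuousM => //; apply: mcontinuous_partial_avg;
    exact: mcontinuousM.
rewrite id_avg_opE; [|exact: mcontinuous_row_mx|exact: mcontinuous_col_mx].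
congr L2class; apply/funext => k; rewrite -addrA; congr (_ + _).
rewrite /avg_fun (_ : partial_avg j (fun l => col_mx (B1 l) (B2 l) *m _) k =
    col_mx (partial_avg j (fun l => B1 l *m L2_to_fun u l) k)
           (partial_avg j (fun l => B2 l *m L2_to_fun u l) k)) ?mul_row_col//.
apply/matrixP => a b; case: (split_ordP a) => a' ->.
  rewrite col_mxEu !mxE; apply: eq_cube_integral => x _.
  by rewrite mul_col_mx col_mxEu.
rewrite col_mxEd !mxE; apply: eq_cube_integral => x _.
by rewrite mul_col_mx col_mxEd.
Qed.

(** Brings the minus sign of the inverse formula into the form to which the composition lemmas
    apply. *)
Lemma avg_opN p (A : 'rV[R]_N -> 'M[R[i]]_(M, p)) (B : 'rV[R]_N -> 'M[R[i]]_(p, M)) :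
  mcontinuous A -> mcontinuous B ->
  id \- avg_op j A B = id \+ avg_op j (fun k => - A k) B.
Proof.
move=> Ac Bc; apply/funext => u; congr (_ + _).
rewrite -scaleN1r -L2classZ; last by apply: (mL2_avg_fun jN Ac Bc); exact: L2_to_fun_mL2.
by congr L2class; apply/funext => k; rewrite scaleN1r mulNmx.
Qed.

Section inverse_formula.
Variables (p : nat).
Variables (A : 'rV[R]_N -> 'M[R[i]]_(M, p)) (B : 'rV[R]_N -> 'M[R[i]]_(p, M)).
Hypotheses (Ac : mcontinuous A) (Bc : mcontinuous B).
Let D k := 1%:M + partial_avg j (fun l => B l *m A l) k.

Lemma mcontinuous_one_add_avg : mcontinuous D.
Proof.
apply: mcontinuousD; first exact: mcontinuous_cst.
by apply: mcontinuous_partial_avg; exact: mcontinuousM.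
Qed.

Hypothesis D0 : forall k, cube R N k -> \det (D k) != 0.

Let unitD k : cube R N k -> D k \in unitmx.
Proof. by move=> ck; rewrite unitmxE unitfE D0. Qed.

Let AD k := - (A k *m invmx (D k)).

Lemma mcontinuous_inverse_coef : mcontinuous AD.
Proof.
apply: mcontinuousN; apply: mcontinuousM => //.
exact: mcontinuous_invmx mcontinuous_one_add_avg D0.
Qed.

(** With the same [B1] in both factors the composite is u + (A1 + A2 + A1 <B1 A2>) <B1 u>, so one
    coefficient identity suffices for either order of the inverse. *)
Let cancel_comp q (A1 : 'rV[R]_N -> 'M[R[i]]_(M, q)) (A2 : 'rV[R]_N -> 'M[R[i]]_(M, q))
    (B1 : 'rV[R]_N -> 'M[R[i]]_(q, M)) u :
  (forall k, cube R N k -> A1 k + A2 k + A1 k *m partial_avg j (fun l => B1 l *m A2 l) k = 0) ->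
  mcontinuous A1 -> mcontinuous B1 -> mcontinuous A2 ->
  ((id \+ avg_op j A1 B1) \o (id \+ avg_op j A2 B1)) u = u.
Proof.
move=> A0 A1c B1c A2c; rewrite id_avg_op_comp// -[RHS]L2_to_funK.
have u2 := L2_to_fun_mL2 u.
have A'c : mcontinuous (fun k => A2 k + A1 k *m partial_avg j (fun l => B1 l *m A2 l) k).
  by apply: mcontinuousD => //; apply: mcontinuousM => //; apply: mcontinuous_partial_avg;
    exact: mcontinuousM.
apply: L2class_eq => //.
  by apply: mL2D; [apply: mL2D => //|]; exact: mL2_avg_fun.
apply: aeW => k ck; rewrite -addrA /avg_fun -mulmxDl addrA A0// mul0mx addr0.
by [].
Qed.

Lemma id_avg_op_inverse :
  inverse_operator (id \+ avg_op j A B) (id \+ avg_op j AD B).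
Proof.
split; apply/funext => u; apply: @cancel_comp => //;
  try exact: mcontinuous_inverse_coef.
- move=> k ck.
  (* The inverse of D is constant along slices and leaves the average, so the coefficient becomes A
     - A (I + <B A>) D^-1 = 0. *)
  have -> : partial_avg j (fun l => B l *m AD l) k =
      - (partial_avg j (fun l => B l *m A l) k *m invmx (D k)).
    rewrite -mulmxN -(@partial_avgMr R N j _ _ _ _ (fun l => - invmx (D l))).
    - have -> // : (fun l => B l *m AD l) = fun l => B l *m A l *m - invmx (D l).
      by apply/funext => l; rewrite /AD !mulmxN mulmxA.
    - exact: mcontinuous_slice_mL2 (mcontinuousM Bc Ac) ck.
    - by move=> x cx; rewrite /D partial_avg_splice.
  rewrite /AD mulmxN -addrA -opprD mulmxA -mulmxDl -{2}[A k]mulmx1 -mulmxDr -/(D k).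
  by rewrite -mulmxA mulmxV ?unitD// mulmx1 subrr.
(* In this order D^-1 already stands outside the average, and the coefficient is A - A D^-1 (I + <B
   A>) = 0. *)
- move=> k ck; rewrite /AD addrAC mulNmx -opprD -{1}[A k *m invmx (D k)]mulmx1 -mulmxDr.
  by rewrite -/(D k) -mulmxA mulVmx ?unitD// mulmx1 addNr.
Qed.

End inverse_formula.

End identity_plus_averaging.

(** * Approximate kernel vectors of a singular slice *)

Section singular_directions.
Variable R : realType.
Local Notation mu N := (lebesgue_rV R N).

Lemma measurable_coord_bigcap n (P : 'I_n -> set R) : (forall i, measurable (P i)) ->
  measurable [set x : 'rV[R]_n | forall i, P i (x ord0 i)].
Proof.
move=> mP; rewrite (_ : mkset _ = \bigcap_(i in [set: 'I_n])
    ((fun x : 'rV[R]_n => x ord0 i) @^-1` P i)).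
  apply: fin_bigcap_measurable => // i _; rewrite -[X in measurable X]setTI.
  exact: measurable_rV_coord.
by apply/seteqP; split => [x xP i _|x xP i] /=; [exact: xP|exact: (xP i I)].
Qed.

Lemma measurable_rV_box n (a b : 'I_n -> R) :
  measurable [set x : 'rV[R]_n | forall i, a i <= x ord0 i <= b i].
Proof.
have := @measurable_coord_bigcap n (fun i => [set` `[a i, b i]]) (fun i => measurable_itv _).
by congr measurable; apply/seteqP; split => x xab i; have := xab i; rewrite /= in_itv.
Qed.

(** Keeps the approximate kernel vector from being the zero class. *)
Lemma lebesgue_rV_box_gt0 n (a b : 'I_n -> R) : (forall i, a i < b i) ->
  (0 < mu n [set x : 'rV[R]_n | forall i, (a i <= x ord0 i <= b i)%R])%E.
Proof.
elim: n a b => [|n IHn] a b ab /=; first by rewrite diracE mem_set ?lte01// => -[].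
rewrite /lebesgue_step /pushforward (_ : _ @^-1` _ = `[a ord0, b ord0] `*`
    [set x : 'rV[R]_n | forall i, a (lift ord0 i) <= x ord0 i <= b (lift ord0 i)]).
  rewrite product_measure1E//; last exact: (measurable_rV_box (a \o lift ord0) (b \o lift ord0)).
  apply: mule_gt0; last exact: IHn.
  have := @lebesgue_measure_itv R `[a ord0, b ord0]; rewrite /= lte_fin ab => ->.
  by rewrite -EFinB lte_fin subr_gt0 ab.
apply/seteqP; split => [[x y] xy|[x y] [/= x01 y01] i] /=.
  split => [|i] /=; first by rewrite in_itv/=; have := xy ord0; rewrite cons_rV0.
  by have := xy (lift ord0 i); rewrite cons_rVS.
case: (unliftP ord0 i) => [l|] ->; first by rewrite cons_rVS.
by rewrite cons_rV0; move: x01; rewrite in_itv.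
Qed.

Lemma cube_continuous_sqnorm_cV N m (h : 'rV[R]_N -> 'cV[R[i]]_m) : mcontinuous h ->
  {within cube R N, continuous (fun k => sqnorm_cV (h k))}.
Proof.
move=> hc; rewrite /sqnorm_cV; elim: (index_enum _) => [|i r IHr].
  by under eq_fun do rewrite big_nil; move=> x; exact: cvg_cst.
under eq_fun do rewrite big_cons; move=> x; apply: cvgD; last exact: IHr.
have [rc ic] := hc i ord0; rewrite /sqnormC.
by apply: cvgD; rewrite expr2; apply: cvgM; [exact: rc|exact: rc|exact: ic|exact: ic].
Qed.

(* v times the indicator of a small neighbourhood of k0 in the last N - j variables. *)
Lemma approximate_kernel N j p (D : 'rV[R]_N -> 'M[R[i]]_p) k0 (v : 'cV_p) (eta : R) :
  mcontinuous D ->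
  (forall (x : 'rV[R]_j) k, cube R j x -> cube R N k -> D (splice x k) = D k) ->
  cube R N k0 -> D k0 *m v = 0 -> v != 0 -> 0 < eta ->
  exists f : 'rV[R]_N -> 'cV[R[i]]_p,
    [/\ mL2 f, forall (x : 'rV[R]_j) k, f (splice x k) = f k, (0 < sqL2 f)%E &
        forall k, cube R N k -> sqnorm_cV (D k *m f k) <= eta * sqnorm_cV (f k)].
Proof.
move=> Dc Dsplice ck0 Dv0 v0 eta0; have mcN := measurable_cube R N.
have v_gt0 : 0 < sqnorm_cV v.
  rewrite lt_neqAle sqnorm_cV_ge0 andbT eq_sym; apply: contra v0 => /eqP v0.
  apply/eqP/matrixP => i l; rewrite ord1 mxE; apply/eqP; rewrite -[_ == _]negbK -sqnormC_gt0.
  rewrite -leNgt -v0 /sqnorm_cV (bigD1 i)//= lerDl sumr_ge0// => ? _; exact: sqnormC_ge0.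
have Dvc : mcontinuous (fun k => D k *m v).
  by apply: mcontinuousM => //; exact: mcontinuous_cst.
(* The squared norm of D v vanishes at [k0], so it stays below [eta * sqnorm_cV v] near [k0]. *)
have /cube_continuousP /(_ k0 ck0 (eta * sqnorm_cV v)) := cube_continuous_sqnorm_cV Dvc.
case; first exact: mulr_gt0.
move=> d d0 kd.
(* With indices from 0, the last N - j variables are those with [j <= i]. *)
pose E := [set k : 'rV[R]_N | forall i : 'I_N, (j <= i)%N -> `|k0 ord0 i - k ord0 i| < d].
have mE : measurable E.
  pose P (i : 'I_N) : set R := if (j <= i)%N then [set` `]k0 ord0 i - d, k0 ord0 i + d[] else setT.
  rewrite (_ : E = [set k : 'rV[R]_N | forall i, P i (k ord0 i)]).
    by apply: measurable_coord_bigcap => i; rewrite /P; case: ifP.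
  apply/seteqP; split => k kE i; have := kE i; rewrite /P; case: ifP => //= ji.
    by move=> /(_ isT); rewrite distrC ltr_distl in_itv.
  by rewrite in_itv/= distrC ltr_distl.
pose f k : 'cV[R[i]]_p := if k \in E then v else 0.
(* [f] is [v] times an indicator, so a functional that vanishes at 0 turns it into a multiple of the
   indicator. *)
have fE (w : 'cV[R[i]]_p -> R) : w 0 = 0 -> (fun k => w (f k)) = fun k => \1_E k * w v.
  move=> w0; apply/funext => k; rewrite /f indicE; case: (k \in E); rewrite ?mul1r//.
  by rewrite mul0r w0.
have f2 : mL2 f.
  move=> i l; have h1 : measurable_fun (cube R N) (\1_E : 'rV[R]_N -> R).
    exact: measurable_indic.
  have h2 k : cube R N k -> `|(\1_E k : R)| <= 1.
    by move=> _; rewrite indicE; case: (k \in E); rewrite ?normr1 ?normr0.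
  split.
    by rewrite (fE (fun w => complex.Re (w i l))) ?mxE//; apply: (L2rM h1 h2); exact: L2r_cst.
  by rewrite (fE (fun w => complex.Im (w i l))) ?mxE//; apply: (L2rM h1 h2); exact: L2r_cst.
exists f; split => //.
- move=> x k; rewrite /f; suff -> : (splice x k \in E) = (k \in E) by [].
  apply/idP/idP => /set_mem kE; apply/mem_set => i ji; have := kE i ji; rewrite mxE;
    by rewrite insubF// ltnNge ji.
- rewrite /sqL2 (eq_integral (fun k => (sqnorm_cV v)%:E * (\1_E k)%:E)%E); last first.
    move=> k _; rewrite -EFinM mulrC.
    rewrite -(congr1 (fun g => g k) (fE (@sqnorm_cV R p) _))//.
    by rewrite /sqnorm_cV big1// => i _; rewrite mxE /sqnormC/= expr0n addr0.
  rewrite ge0_integralZl//; last 2 first.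
  - by apply/measurable_EFinP; exact: measurable_indic.
  - by rewrite lee_fin sqnorm_cV_ge0.
  rewrite integral_indic// mule_gt0// ?lte_fin//.
  (* A box of half-side [d / 2] about [k0], clipped to the cube. Its sides stay positive even when
     [k0] is on the boundary, and [d / 2] yields the strict inequality in [E]. *)
  pose a (i : 'I_N) := Num.max 0 (k0 ord0 i - d / 2).
  pose b (i : 'I_N) := Num.min 1 (k0 ord0 i + d / 2).
  have ab i : a i < b i.
    have /andP[? ?] := ck0 i.
    by rewrite gt_max !lt_min; apply/andP; split; apply/andP; split; lra.
  apply: lt_le_trans (lebesgue_rV_box_gt0 ab) _; apply: le_measure; rewrite ?inE.
  - exact: measurable_rV_box.
  - exact: measurableI.
  move=> k kab; split.
    move=> i _; have := kab i; rewrite /a /b ge_max le_min => /andP[/andP[? ?] /andP[? ?]].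
    by rewrite ltr_norml; apply/andP; split; lra.
  move=> i; have := kab i; rewrite /a /b ge_max le_min => /andP[/andP[? ?] /andP[? ?]].
  exact/andP.
- move=> k ck; rewrite /f; case: ifPn => [/set_mem kE|_]; last first.
    by rewrite mulmx0 /sqnorm_cV big1 ?mulr0// => i _; rewrite mxE /sqnormC/= expr0n addr0.
  (* Giving [k] the first j coordinates of [k0] does not change D and brings the point within [d] of
     [k0] in every coordinate; the default 0 keeps [x] in the cube. *)
  pose x : 'rV[R]_j := \row_i (if insub (i : nat) is Some i' then k0 ord0 i' else 0).
  have cx : cube R j x.
    by move=> i; rewrite mxE; case: insubP => [i' _ _|_]; [exact: ck0|rewrite lexx ler01].
  rewrite -(Dsplice x k cx ck).
  have := kd _ (cube_splice cx ck); rewrite Dv0.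
  have -> : sqnorm_cV (0 : 'cV[R[i]]_p) = 0.
    by rewrite /sqnorm_cV big1// => i _; rewrite mxE /sqnormC/= expr0n addr0.
  rewrite sub0r normrN ger0_norm ?sqnorm_cV_ge0//.
  move=> H; apply/ltW/H => i; rewrite !mxE; case: insubP => [i' _ ii'|].
    by rewrite mxE ii' valK subrr normr0.
  by rewrite -leqNgt => ji; exact: kE.
Qed.

End singular_directions.

(** * Invertibility criterion and group structure *)

Section invertibility_criterion.
Variables (R : realType) (N M j : nat).
Hypothesis jN : (j <= N)%N.

Lemma sqL2_fineK p (u : 'rV[R]_N -> 'cV[R[i]]_p) : mL2 u ->
  sqL2 u = (fine (sqL2 u))%:E.
Proof. by move=> u2; rewrite fineK// ge0_fin_numE ?sqL2_ge0// sqL2_lty. Qed.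

Lemma fine_sqL2_le p q (u : 'rV[R]_N -> 'cV[R[i]]_p) (v : 'rV[R]_N -> 'cV[R[i]]_q) (C : R) :
  mL2 u -> mL2 v -> (sqL2 u <= C%:E * sqL2 v)%E -> fine (sqL2 u) <= C * fine (sqL2 v).
Proof.
by move=> u2 v2; rewrite (sqL2_fineK u2) (sqL2_fineK v2) -EFinM lee_fin.
Qed.

(** [X], [W], [Z], [Y] are the squared norms of f, D f, A D f and A f. The chain gives
    [X <= (2 + 2 * K) * W], and eps = [(4 + 4 * K)^-1] is the value that makes the right side at
    most [X / 2]. *)
Lemma approximate_kernel_absurd (X W Y Z c CA CB : R) : 0 <= CA -> 0 <= CB -> 0 < X ->
  Y <= c ^+ 2 * Z -> Z <= CA * W -> W <= (4 + 4 * (CB * c ^+ 2 * CA))^-1 * X ->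
  X <= 2 * W + 2 * (CB * Y) -> False.
Proof.
move=> CA0 CB0 X0 YZ ZW WX XWY; set K := CB * c ^+ 2 * CA in WX.
have K0 : 0 <= K by apply: mulr_ge0 => //; apply: mulr_ge0 => //; exact: sqr_ge0.
have YW : CB * Y <= K * W.
  have cZ : c ^+ 2 * Z <= c ^+ 2 * (CA * W) by apply: ler_wpM2l; first exact: sqr_ge0.
  have -> : K * W = CB * (c ^+ 2 * (CA * W)) by rewrite /K !mulrA.
  by apply: ler_wpM2l => //; exact: le_trans YZ cZ.
have XW : X <= (2 + 2 * K) * W by lra.
have : (2 + 2 * K) * W <= X / 2.
  have -> : X / 2 = (2 + 2 * K) * ((4 + 4 * K)^-1 * X) by field; lra.
  by rewrite ler_wpM2l//; lra.
lra.
Qed.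

Lemma slice_constant_det_neq0 p (A : 'rV[R]_N -> 'M[R[i]]_(M, p))
    (B : 'rV[R]_N -> 'M[R[i]]_(p, M)) (S : L2 R N M -> L2 R N M) :
  mcontinuous A -> mcontinuous B -> bounded_operator S ->
  S \o (id \+ avg_op j A B) = id -> forall k, cube R N k ->
  \det (1%:M + partial_avg j (fun q => B q *m A q) k) != 0.
Proof.
move=> Ac Bc [_ [c Sc]] ST k0 ck0; apply/negP => detD0.
pose D k := 1%:M + partial_avg j (fun q => B q *m A q) k.
have Dc : mcontinuous D by exact: mcontinuous_one_add_avg.
have [w w0 wD] : exists2 w : 'cV[R[i]]_p, w != 0 & D k0 *m w = 0.
  (* [det0P] yields a row vector in the left kernel, hence the transposition. *)
  move: detD0; rewrite -/(D k0) -det_tr => /det0P[v v0 vD].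
  exists v^T; first by rewrite trmx_eq0.
  by rewrite -[D k0]trmxK -trmx_mul vD trmx0.
have [CA CA0 hA] := sqL2_mulmx Ac; have [CB CB0 hB] := sqL2_mulmx Bc.
pose K := CB * c ^+ 2 * CA.
have K0 : 0 <= K by apply: mulr_ge0 => //; apply: mulr_ge0 => //; exact: sqr_ge0.
have eta0 : 0 < (4 + 4 * K)^-1 by rewrite invr_gt0; lra.
have Dsplice (x : 'rV[R]_j) k : cube R j x -> cube R N k -> D (splice x k) = D k.
  by move=> _ _; rewrite /D partial_avg_splice.
have [f [f2 fsplice f_gt0 fD]] := approximate_kernel Dc Dsplice ck0 wD w0 eta0.
have Af2 := mL2M Ac f2; have Df2 := mL2M Dc f2; have ADf2 := mL2M Ac Df2.
have BAf2 := mL2M Bc Af2.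
have avgE k : cube R N k ->
    partial_avg j (fun l => B l *m (A l *m f l)) k = partial_avg j (fun l => B l *m A l) k *m f k.
  move=> ck; rewrite -(@partial_avgMr R N j).
  - by have -> // : (fun l => B l *m (A l *m f l)) = fun l => B l *m A l *m f l;
      apply/funext => l; rewrite mulmxA.
  - exact: mcontinuous_slice_mL2 (mcontinuousM Bc Ac) ck.
  - by move=> x _; exact: fsplice.
have TAf : (id \+ avg_op j A B) (L2class (fun k => A k *m f k)) =
    L2class (fun k => A k *m (D k *m f k)).
  rewrite (id_avg_op_class jN Ac Bc Af2).
  apply: (L2class_eq (mL2D Af2 (mL2_avg_fun jN Ac Bc Af2)) ADf2).
  by apply: aeW => k ck; rewrite /avg_fun avgE// -mulmxDr /D mulmxDl mul1mx.
have h1 : fine (sqL2 (fun k => A k *m f k)) <=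
    c ^+ 2 * fine (sqL2 (fun k => A k *m (D k *m f k))).
  have := Sc ((id \+ avg_op j A B) (L2class (fun k => A k *m f k))).
  have -> : S ((id \+ avg_op j A B) (L2class (fun k => A k *m f k))) =
      L2class (fun k => A k *m f k) by exact: (congr1 (fun g => g _) ST).
  rewrite TAf !L2norm_class// => H.
  have := sqL2_ge0 (fun k => A k *m f k); have := sqL2_ge0 (fun k => A k *m (D k *m f k)).
  move=> /fine_ge0 Y0 /fine_ge0 X0.
  (* No sign is known for [c]; the bound [H] itself shows that its right-hand side is nonnegative,
     which allows squaring. *)
  rewrite -(sqr_sqrtr X0) -(sqr_sqrtr Y0) -exprMn ler_sqr// nnegrE ?sqrtr_ge0//.
  exact: le_trans H.
have h2 := fine_sqL2_le ADf2 Df2 (hA _ Df2).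
have h3 : fine (sqL2 (fun k => D k *m f k)) <= (4 + 4 * K)^-1 * fine (sqL2 f).
  by apply: fine_sqL2_le => //; apply: sqL2_le => //; exact: ltW.
have Pf2 := mL2_partial_avg jN BAf2.
have N2 : mL2 (fun k => - partial_avg j (fun l => B l *m (A l *m f l)) k).
  have := mL2Z (-1) Pf2.
  by under eq_fun do rewrite scaleN1r.
have h4 : fine (sqL2 f) <= 2 * fine (sqL2 (fun k => D k *m f k)) +
    2 * (CB * fine (sqL2 (fun k => A k *m f k))).
  have fE k : cube R N k ->
      f k = D k *m f k + - partial_avg j (fun l => B l *m (A l *m f l)) k.
    by move=> ck; rewrite avgE// /D mulmxDl mul1mx addrK.
  have -> : sqL2 f =
      sqL2 (fun k => D k *m f k + - partial_avg j (fun l => B l *m (A l *m f l)) k).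
    by apply: eq_integral => k /set_mem ck; rewrite -fE.
  have NE : sqL2 (fun k => - partial_avg j (fun l => B l *m (A l *m f l)) k) =
      sqL2 (partial_avg j (fun l => B l *m (A l *m f l))).
    apply: eq_integral => k _; congr (_%:E); apply: eq_bigr => i _.
    by rewrite !mxE /sqnormC !raddfN !sqrrN.
  have := sqL2D Df2 N2; rewrite NE (sqL2_fineK (mL2D Df2 N2)) (sqL2_fineK Df2).
  rewrite (sqL2_fineK Pf2) -!EFinM -EFinD lee_fin => /le_trans; apply.
  rewrite lerD2l ler_wpM2l//; apply: le_trans (fine_sqL2_le BAf2 Af2 (hB _ Af2)).
  by rewrite -lee_fin -(sqL2_fineK Pf2) -(sqL2_fineK BAf2) sqL2_partial_avg.
have X0 : 0 < fine (sqL2 f) by rewrite fine_gt0// f_gt0 sqL2_lty.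
exact: (approximate_kernel_absurd CA0 CB0 X0 h1 h2 h3 h4).
Qed.

Lemma left_inverse_eq_right (X : Type) (T S T' : X -> X) :
  T \o S = id -> T' \o T = id -> T' = S.
Proof.
move=> TS T'T; apply/funext => u.
by rewrite -[in LHS](congr1 (fun g => g u) TS); exact: (congr1 (fun g => g (S u)) T'T).
Qed.

(** Uniform in [j], including [j = 0], where it is the set of multiplication operators
    ([calH0E]). *)
Definition avg_perturbation : set (L2 R N M -> L2 R N M) :=
  [set T | exists p (A : 'rV[R]_N -> 'M[R[i]]_(M, p)) (B : 'rV[R]_N -> 'M[R[i]]_(p, M)),
     [/\ (0 < p)%N, mcontinuous A, mcontinuous B & T = id \+ avg_op j A B]].

Lemma bounded_operator_comp (T S : L2 R N M -> L2 R N M) :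
  bounded_operator T -> bounded_operator S -> bounded_operator (T \o S).
Proof.
move=> [lT [c cT]] [lS [d dS]]; split; first by move=> a u v; rewrite /= lS lT.
exists (`|c| * `|d|) => u; rewrite -mulrA.
have le_abs (e x y : R) : 0 <= y -> x <= e * y -> x <= `|e| * y.
  by move=> y0 /le_trans; apply; rewrite ler_wpM2r// ler_norm.
apply: le_trans (le_abs _ _ _ _ (cT (S u))) _; first exact: sqrtr_ge0.
by rewrite ler_wpM2l//; apply: le_abs (dS u); exact: sqrtr_ge0.
Qed.

(** The condition is tested on whichever pair represents the operator, not on a well-chosen one; the
    inverse formula for given [A] and [B] relies on this. *)
Lemma Inv_avg_perturbation p (A : 'rV[R]_N -> 'M[R[i]]_(M, p)) (B : 'rV[R]_N -> 'M[R[i]]_(p, M)) :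
  (0 < p)%N -> mcontinuous A -> mcontinuous B ->
  Defs.Inv avg_perturbation (id \+ avg_op j A B) <->
  (forall k, cube R N k -> \det (1%:M + partial_avg j (fun q => B q *m A q) k) != 0).
Proof.
move=> p0 Ac Bc; split=> [[_ _ [S Sb [_ ST]]]|D0].
  exact: (slice_constant_det_neq0 Ac Bc Sb ST).
have ADc := mcontinuous_inverse_coef Ac Bc D0.
split; first by exists p, A, B.
  exact: bounded_id_avg_op.
eexists; last exact: (id_avg_op_inverse jN Ac Bc D0).
exact: bounded_id_avg_op.
Qed.

Lemma Inv_avg_perturbation_group : is_operator_group (Defs.Inv avg_perturbation).
Proof.
split.
(* The identity is written with zero coefficients of inner size 1, since the inner size must be
   positive. *)
- pose Z m n : 'rV[R]_N -> 'M[R[i]]_(m, n) := fun=> 0.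
  have Zc m n : mcontinuous (Z m n) by exact: mcontinuous_cst.
  have avg0 : partial_avg j (fun q => Z 1 M q *m Z M 1 q) = fun=> 0.
    apply/funext => k; apply/matrixP => a b; rewrite !mxE -[RHS](cube_integral_cst j).
    by apply: eq_cube_integral => x _; rewrite mul0mx mxE.
  suff -> : id = id \+ avg_op j (Z M 1) (Z 1 M).
    apply/Inv_avg_perturbation => // k _.
    by rewrite avg0 addr0 det1 oner_neq0.
  apply/funext => u; rewrite id_avg_opE// -[LHS]L2_to_funK.
  by congr L2class; apply/funext => k; rewrite /avg_fun mul0mx addr0.
- move=> T S [[p [A [B [p0 Ac Bc TE]]]] Tb [T' T'b [TT' T'T]]]
    [[q [A' [B' [q0 A'c B'c SE]]]] Sb [S' S'b [SS' S'S]]].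
  split; last first.
    exists (S' \o T'); first exact: bounded_operator_comp.
    split; apply/funext => u /=.
      have -> : S (S' (T' u)) = T' u by exact: (congr1 (fun g => g (T' u)) SS').
      exact: (congr1 (fun g => g u) TT').
    have -> : T' (T (S u)) = S u by exact: (congr1 (fun g => g (S u)) T'T).
    exact: (congr1 (fun g => g u) S'S).
    exact: bounded_operator_comp.
  rewrite TE SE id_avg_op_compE//; do 3 eexists; split; last reflexivity.
  + by rewrite addn_gt0 p0.
  + apply: mcontinuous_row_mx => //; apply: mcontinuousD => //; apply: mcontinuousM => //.
    by apply: mcontinuous_partial_avg; exact: mcontinuousM.
  + exact: mcontinuous_col_mx.
- move=> _ [[p [A [B [p0 Ac Bc ->]]]] Tb [T' T'b [TT' T'T]]].
  (* The bounded inverse [T'] forces the determinants to be nonzero, so the explicit right inverse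
     exists; by uniqueness [T'] equals it and has the required form. *)
  have D0 := slice_constant_det_neq0 Ac Bc T'b T'T.
  have [TS _] := id_avg_op_inverse jN Ac Bc D0.
  exists T'; last by split.
  split => //; last by exists (id \+ avg_op j A B).
  exists p, (fun k => - (A k *m invmx (1%:M + partial_avg j (fun l => B l *m A l) k))), B.
  split => //; first exact: (mcontinuous_inverse_coef Ac Bc D0).
  exact: (left_inverse_eq_right TS T'T).
Qed.

End invertibility_criterion.

(** * The case j = 0: multiplication operators *)

Section multiplication_operators.
Variables (R : realType) (N M : nat).

(** Splicing an empty row changes nothing, and the cube of dimension 0 has measure 1. *)
Lemma partial_avg0 m n (F : 'rV[R]_N -> 'M[R[i]]_(m, n)) : partial_avg 0 F = F.
Proof.
apply/funext => k; apply/matrixP => a b; rewrite mxE -[RHS](@cube_integral_cst R 0).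
apply: eq_cube_integral => x _; congr (F _ _ _); apply/rowP => i; rewrite mxE.
by rewrite insubF.
Qed.

Lemma id_avg_op0 p (A : 'rV[R]_N -> 'M[R[i]]_(M, p)) (B : 'rV[R]_N -> 'M[R[i]]_(p, M)) :
  mcontinuous A -> mcontinuous B ->
  id \+ avg_op 0 A B = mul_op (fun k => 1%:M + A k *m B k).
Proof.
move=> Ac Bc; apply/funext => u; rewrite id_avg_opE//; congr L2class; apply/funext => k.
by rewrite /avg_fun partial_avg0 mulmxDl mul1mx mulmxA.
Qed.

Lemma mul_opE (A : 'rV[R]_N -> 'M[R[i]]_M) : mcontinuous A ->
  mul_op A = id \+ avg_op 0 (fun k => A k - 1%:M) (fun=> 1%:M).
Proof.
move=> Ac; rewrite id_avg_op0.
- by congr mul_op; apply/funext => k; rewrite mulmx1 addrC subrK.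
- by apply: mcontinuousD => //; exact: mcontinuous_cst.
- exact: mcontinuous_cst.
Qed.

(** One direction uses inner size [M], whence [0 < M]; in the other, A <B .>_0 is multiplication by
    A B. *)
Lemma calH0E : (0 < M)%N -> calH R N M 0 = @avg_perturbation R N M 0.
Proof.
move=> M0; apply/seteqP; split => T /=.
  move=> [A /mcontinuousP Ac ->]; exists M, (fun k => A k - 1%:M), (fun=> 1%:M).
  split => //; last exact: mul_opE.
    by apply: mcontinuousD => //; exact: mcontinuous_cst.
  exact: mcontinuous_cst.
move=> [p [A [B [p0 Ac Bc ->]]]]; exists (fun k => 1%:M + A k *m B k).
  by apply/mcontinuousP; apply: mcontinuousD; [exact: mcontinuous_cst|exact: mcontinuousM].
exact: id_avg_op0.
Qed.

Lemma calFE j : (0 < M)%N -> calF R N M j = Defs.Inv (@avg_perturbation R N M j).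
Proof.
case: j => [|j] M0; first by rewrite -calH0E.
congr Defs.Inv; apply/seteqP.
split => [_ [T [p [A [B [p0 /mcontinuousP Ac /mcontinuousP Bc ->]]]] <-]|
  _ [p [A [B [p0 Ac Bc ->]]]]].
  by exists p, A, B.
by exists (avg_op j.+1 A B) => //; exists p, A, B; split => //; exact/mcontinuousP.
Qed.

End multiplication_operators.

Theorem theorem1p6 (R : realType) (N M : nat) (hN : (1 <= N)%N) (hM : (1 <= M)%N) :
  [/\ forall j : nat, (j <= N)%N -> is_operator_group (calF R N M j),
      calF R N M 0 =
        [set T | exists A : 'rV[R]_N -> 'M[R[i]]_M,
           [/\ {within cube R N, continuous A},
               forall k, cube R N k -> \det (A k) != 0 &
               T = mul_op A]],
      forall j : nat, (1 <= j <= N)%N ->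
        calF R N M j =
          [set T | exists M' (A : 'rV[R]_N -> 'M[R[i]]_(M, M'))
                             (B : 'rV[R]_N -> 'M[R[i]]_(M', M)),
             [/\ (0 < M')%N,
                 {within cube R N, continuous A},
                 {within cube R N, continuous B},
                 forall k, cube R N k ->
                   \det (1%:M + partial_avg j (fun q => B q *m A q) k) != 0 &
                 T = id \+ avg_op j A B]] &
      forall j : nat, (1 <= j <= N)%N ->
        forall (M' : nat) (A : 'rV[R]_N -> 'M[R[i]]_(M, M'))
               (B : 'rV[R]_N -> 'M[R[i]]_(M', M)),
          (0 < M')%N ->
          {within cube R N, continuous A} ->
          {within cube R N, continuous B} ->
          calF R N M j (id \+ avg_op j A B) ->
          (forall k, cube R N k ->
             1%:M + partial_avg j (fun q => B q *m A q) k \in unitmx) /\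
          inverse_operator (id \+ avg_op j A B)
            (id \- avg_op j
               (fun k => A k *m invmx (1%:M + partial_avg j (fun q => B q *m A q) k))
               B)].
Proof.
(* For the pair (A - I, I) the matrix I + <B A>_0 of the criterion is A itself. *)
have det0 (A : 'rV[R]_N -> 'M[R[i]]_M) k :
    1%:M + partial_avg 0 (fun q => 1%:M *m (A q - 1%:M)) k = A k.
  by rewrite partial_avg0 mul1mx addrC subrK.
have A1c (A : 'rV[R]_N -> 'M[R[i]]_M) : mcontinuous A -> mcontinuous (fun k => A k - 1%:M).
  by move=> Ac; apply: mcontinuousD => //; exact: mcontinuous_cst.
have c1 : mcontinuous (fun _ : 'rV[R]_N => 1%:M : 'M[R[i]]_M) by exact: mcontinuous_cst.
split.
- by move=> j jN; rewrite (calFE _ _ _ hM); exact: Inv_avg_perturbation_group.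
- rewrite (calFE _ _ _ hM); apply/seteqP; split => T.
    move=> TI; have [+ _ _] := TI; rewrite -(calH0E _ _ hM) => -[A Ac TE].
    exists A; split => //; move/mcontinuousP in Ac.
    move: TI; rewrite TE (mul_opE Ac).
    move=> /(Inv_avg_perturbation (leq0n N) hM (A1c _ Ac) c1) D0 k ck.
    by have := D0 k ck; rewrite det0.
  move=> [A [/mcontinuousP Ac D0 ->]]; rewrite (mul_opE Ac).
  apply/(Inv_avg_perturbation (leq0n N) hM (A1c _ Ac) c1) => k ck.
  by rewrite det0; exact: D0.
- move=> j /andP[_ jN]; rewrite (calFE _ _ _ hM); apply/seteqP; split => T.
    move=> TI; have [[p [A [B [p0 Ac Bc TE]]]] _ _] := TI.
    exists p, A, B; split => //; [exact/mcontinuousP|exact/mcontinuousP|].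
    by apply/(Inv_avg_perturbation jN p0 Ac Bc); rewrite -TE.
  move=> [p [A [B [p0 /mcontinuousP Ac /mcontinuousP Bc D0 ->]]]].
  exact/(Inv_avg_perturbation jN p0 Ac Bc).
- move=> j /andP[_ jN] p A B p0 /mcontinuousP Ac /mcontinuousP Bc.
  rewrite (calFE _ _ _ hM) => /(Inv_avg_perturbation jN p0 Ac Bc) D0.
  split; first by move=> k ck; rewrite unitmxE unitfE D0.
  have ADc : mcontinuous (fun k => A k *m invmx (1%:M + partial_avg j (fun q => B q *m A q) k)).
    by apply: mcontinuousM => //; apply: mcontinuous_invmx D0; exact: mcontinuous_one_add_avg.
  rewrite (avg_opN jN ADc Bc); exact: (id_avg_op_inverse jN Ac Bc D0).
Qed.
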